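(* Let $\mu$ be a probability measure on $S$ which is the law of $Y_1=X_1^*$, where $(X_n)$ is an i.i.d. sequence in $S$ satisfying $\mathbb P\bigl(\bigcup_{n\ge1}[X_n\cdots X_1\in S^\circ]\bigr)>0$, and let $\nu$ be the unique $\mu$-invariant probability measure on $\overline B$. Then $P$ acts as a bounded operator on $\mathcal L$, and for every $\kappa_0\in\,]\kappa(\mu),1[$ there exists $C>0$ such that $\|P^n-\Pi\|_{\mathcal L}\le C\kappa_0^n$ for all $n\ge1$, where $\|\cdot\|_{\mathcal L}$ also denotes the operator norm on $\mathcal L$.
   Context: $S$ is the semigroup of real $q\times q$ matrices with nonnegative entries such that every row and every column contains a strictly positive entry; $S^\circ$ the subset with all entries strictly positive. $\|x\|=\sum_i|x_i|$; $\overline B=\{x\in\mathbb R^q: x_i\ge0,\ \|x\|=1\}$; $g\cdot x=gx/\|gx\|$. For $x,y\in\overline B$, $m(x,y)=\min\{x_i/y_i:y_i>0\}$ and $d(x,y)=\frac{1-m(x,y)m(y,x)}{1+m(x,y)m(y,x)}$, a distance on $\overline B$ bounded by $1$. $\mu^{(n)}$ denotes the $n$-fold convolution power of $\mu$ (law of $Y_1\cdots Y_n$), $c(\mu^{(n)})=\sup\{\int_S\frac{d(g\cdot y,g\cdot y')}{d(y,y')}d\mu^{(n)}(g):y\ne y'\in\overline B\}$, $\kappa(\mu)=\lim_n c(\mu^{(n)})^{1/n}$ (which is $<1$ here). $\mu$-invariance of $\nu$ means $\int\int f(g\cdot x)d\mu(g)d\nu(x)=\int f d\nu$ for bounded continuous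 $f$. $\mathcal L$ is the Banach space of complex functions $f$ on $\overline B$ with $\mathrm{Lip}(f)=\sup\{|f(x)-f(x')|/d(x,x'):x\ne x'\}<\infty$, normed by $\|f\|_{\mathcal L}=\|f\|_u+\mathrm{Lip}(f)$, $\|f\|_u=\sup_{\overline B}|f|$. $Pf(x)=\int_S f(g\cdot x)d\mu(g)$ and $\Pi f=\nu(f)\mathbf 1$ with $\mathbf 1=1_{\overline B}$. *)

(* Defs.v *)
From HB Require Import structures.
From mathcomp Require Import all_boot all_order all_algebra.
From mathcomp Require Import all_classical all_reals all_analysis.
From mathcomp Require Import complex.
Set Implicit Arguments. Unset Strict Implicit. Unset Printing Implicit Defensive.
Import Order.TTheory GRing.Theory Num.Theory.
Import numFieldNormedType.Exports.
Local Open Scope classical_set_scope.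
Local Open Scope ring_scope.

Definition mxgen (R : realType) (m n : nat) : set (set 'M[R]_(m, n)) :=
  [set A : set 'M[R]_(m, n) | exists (i : 'I_m) (j : 'I_n) (B : set R),
           measurable B /\ A = [set M : 'M[R]_(m, n) | B (M i j)]].

Notation MatT R q := (g_sigma_algebraType (@mxgen R q q)).
Notation VecT R q := (g_sigma_algebraType (@mxgen R q 1)).

Section Defs.
Variable R : realType.
Variable q : nat.

Definition inS (g : 'M[R]_q) : Prop :=
  [/\ (forall i j, 0 <= g i j),
      (forall i, exists j, 0 < g i j) &
      (forall j, exists i, 0 < g i j)].
Definition inSo (g : 'M[R]_q) : Prop := forall i j, 0 < g i j.

Definition l1norm (x : 'cV[R]_q) : R := \sum_i `|x i 0|.
Definition Bbar : set 'cV[R]_q :=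
  [set x : 'cV[R]_q | (forall i, 0 <= x i 0) /\ l1norm x = 1].
Definition act (g : 'M[R]_q) (x : 'cV[R]_q) : 'cV[R]_q :=
  (l1norm (g *m x))^-1 *: (g *m x).

Definition mfun (x y : 'cV[R]_q) : R :=
  fine (\big[Order.min/+oo%E]_(i | 0 < y i 0) ((x i 0 / y i 0)%:E)).
Definition dist (x y : 'cV[R]_q) : R :=
  (1 - mfun x y * mfun y x) / (1 + mfun x y * mfun y x).

Definition cabs (z : R[i]) : R := Num.sqrt (complex.Re z ^+ 2 + complex.Im z ^+ 2).

Definition supnorm (f : 'cV[R]_q -> R[i]) : \bar R :=
  ereal_sup [set (cabs (f x))%:E | x in Bbar].
Definition Lip (f : 'cV[R]_q -> R[i]) : \bar R :=
  ereal_sup [set (cabs (f p.1 - f p.2) / dist p.1 p.2)%:E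
            | p in [set p : 'cV[R]_q * 'cV[R]_q | Bbar p.1 /\ Bbar p.2 /\ p.1 <> p.2]].
Definition normL (f : 'cV[R]_q -> R[i]) : \bar R := (supnorm f + Lip f)%E.
(* membership in the space L (functions are only looked at on Bbar) *)
Definition inL (f : 'cV[R]_q -> R[i]) : Prop := (Lip f < +oo)%E.

Definition opnorm (T : ('cV[R]_q -> R[i]) -> ('cV[R]_q -> R[i])) : \bar R :=
  ereal_sup [set normL (T f) | f in [set f | inL f /\ (normL f <= 1)%E]].

Definition cint d (T : measurableType d) (m : {measure set T -> \bar R})
  (D : set T) (f : T -> R[i]) : R[i] :=
  Complex (Rintegral m D (fun t => complex.Re (f t)))
          (Rintegral m D (fun t => complex.Im (f t))).

(* Lprod X n w = X_{n+1} ... X_1   (paper indexing X_1 = X 0) *)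
Fixpoint Lprod (T : Type) (X : nat -> T -> 'M[R]_q) (n : nat) (w : T) : 'M[R]_q :=
  match n with
  | 0 => X 0%N w
  | n'.+1 => X n w *m Lprod X n' w
  end.
(* Yprod X n w = Y_1 ... Y_n with Y_k = X_k^T  (its law is mu^(n)) *)
Definition Yprod (T : Type) (X : nat -> T -> 'M[R]_q) (n : nat) (w : T) : 'M[R]_q :=
  foldr (fun k M => (X k w)^T *m M) 1%:M (iota 0 n).

Definition iid_mx d (Omega : measurableType d) (Pr : probability Omega R)
  (X : nat -> Omega -> 'M[R]_q) : Prop :=
  [/\ (forall n i j, measurable_fun setT (fun w => X n w i j)),
      (forall n (A : set (MatT R q)), measurable A ->
         Pr (X n @^-1` A) = Pr (X 0%N @^-1` A)) &
      (forall (I : seq nat) (A : nat -> set (MatT R q)), uniq I ->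
         (forall k, measurable (A k)) ->
         Pr (\bigcap_(k in [set k | k \in I]) (X k @^-1` A k))
           = (\prod_(k <- I) Pr (X k @^-1` A k))%E)].

(* c(mu^(n)), with mu^(n) the law of Y_1...Y_n *)
Definition cmu d (Omega : measurableType d) (Pr : probability Omega R)
  (X : nat -> Omega -> 'M[R]_q) (n : nat) : \bar R :=
  ereal_sup [set (Rintegral Pr setT
                   (fun w => dist (act (Yprod X n w) p.1) (act (Yprod X n w) p.2))
                  / dist p.1 p.2)%:E
            | p in [set p : 'cV[R]_q * 'cV[R]_q | Bbar p.1 /\ Bbar p.2 /\ p.1 <> p.2]].

Definition kappa d (Omega : measurableType d) (Pr : probability Omega R)
  (X : nat -> Omega -> 'M[R]_q) : R :=
  limn (fun n => fine (cmu Pr X n) `^ (n%:R)^-1).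

Definition Pop (mu : probability (MatT R q) R) (f : 'cV[R]_q -> R[i]) : 'cV[R]_q -> R[i] :=
  fun x => cint mu setT (fun g : MatT R q => f (act g x)).
Definition Piop (nu : probability (VecT R q) R) (f : 'cV[R]_q -> R[i]) : 'cV[R]_q -> R[i] :=
  fun _ => cint nu Bbar f.

Definition mu_invariant (mu : probability (MatT R q) R) (nu : probability (VecT R q) R) : Prop :=
  forall f : 'cV[R]_q -> R,
    (exists M : R, forall x, Bbar x -> `|f x| <= M) ->
    {within Bbar, continuous f} ->
    Rintegral nu Bbar (fun x => Rintegral mu setT (fun g : MatT R q => f (act g x)))
    = Rintegral nu Bbar f.

End Defs.

(* Main.v *)
Require Import Defs.
From HB Require Import structures.
From mathcomp Require Import all_boot all_order all_algebra.
From mathcomp Require Import all_classical all_reals all_analysis.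
From mathcomp Require Import measurable_realfun complex lra ring.
Set Implicit Arguments. Unset Strict Implicit. Unset Printing Implicit Defensive.
Import Order.TTheory GRing.Theory Num.Theory.
Import numFieldNormedType.Exports.
Local Open Scope classical_set_scope.
Local Open Scope ring_scope.

(* MathComp has its own [mfun] and [dist]. *)
Local Notation mfun := Defs.mfun.
Local Notation dist := Defs.dist.

(** The product m(x, y) m(y, x) is invariant under positive scaling of x and y
    and does not decrease when a matrix of S is applied to both, so every g in S
    acts on the simplex as a d-contraction.  A d-Lipschitz function u is Borel on
    the simplex, although it may jump between faces, and the i.i.d. assumption
    gives P^n u(x) = E u(Y_1 ... Y_n . x).  Hence |P^n u(x) - P^n u(y)| is at
    most Lip(u) c(mu^(n)) d(x, y), and integrating in y against the invariant
    measure, with d <= 1, bounds |P^n u(x) - nu(u)| by Lip(u) c(mu^(n)).  As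
    c(mu^(n)) is submultiplicative and at most 1, Fekete's argument gives
    c(mu^(n)) <= C kappa0^n.  Complex functions are split into real and
    imaginary parts, at the cost of a factor 2. *)

(** * The projective contraction *)

Section Geometry.
Variables (R : realType) (q : nat).
Implicit Types (x y : 'cV[R]_q) (g h : 'M[R]_q).

(** [mu_invariant] tests continuous functions only, whereas elements of L need not be continuous;
    invariance is therefore first upgraded to an equality of measures, [one_step] against [nu]. The
    law mu^(n) is never constructed: every average is an integral over the sample space of a kernel
    in two points moved by the same random matrix, so that u(x), u(x) - u(y) and d(x, y) are all
    handled by the single operator [meanY]. Since functions are controlled on the simplex only,
    kernels are cut to zero off it and integrals are compared on sets of full measure. As [kappa] is
    a [limn], the roots must be shown to converge; their limit is their infimum, so one exponent m
    already beats kappa0. The final constant collects a factor 2 from the complex splitting and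
    another 2 from the two halves of the norm. *)

Definition cone x := (forall i, 0 <= x i 0) /\ (exists i, 0 < x i 0).

(** A positive coordinate of y makes the index set nonempty, so the default [+oo] is never the value
    and [fine] loses nothing. *)
Lemma mfun_spec x y : cone y ->
  exists2 i, 0 < y i 0 & mfun x y = x i 0 / y i 0 /\
    forall j, 0 < y j 0 -> mfun x y <= x j 0 / y j 0.
Proof.
case=> y0 [i0 yi0]; rewrite /mfun.
set F := fun i : 'I_q => (x i 0 / y i 0)%:E.
have Fle : forall i, 0 < y i 0 -> (F i <= +oo)%E by move=> i _; rewrite leey.
have -> := @bigmin_eq_arg _ _ _ (+oo)%E i0 (fun i => 0 < y i 0) F yi0 Fle.
case: (@Order.TotalTheory.arg_minP _ _ _ i0 (fun i => 0 < y i 0) F yi0) => i yi Fi.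
by exists i.
Qed.

Lemma mfun_mul_le x y : cone x -> cone y -> forall i, mfun x y * y i 0 <= x i 0.
Proof.
move=> [x0 _] cy i; have [k yk [_ le_m]] := mfun_spec x cy.
case: cy => y0 _; move: (y0 i); rewrite le_eqVlt => /orP[/eqP <-|yi].
  by rewrite mulr0.
by rewrite -ler_pdivlMr// le_m.
Qed.

(** With [mfun_mul_le] this characterises [mfun x y] as the greatest c with c y <= x coordinatewise,
    the form used throughout the geometry below. *)
Lemma mfun_ge x y c : cone y -> (forall i, c * y i 0 <= x i 0) -> c <= mfun x y.
Proof.
move=> cy cyx; have [k yk [-> _]] := mfun_spec x cy.
by rewrite ler_pdivlMr.
Qed.

Lemma mfun_ge0 x y : cone x -> cone y -> 0 <= mfun x y.
Proof. by move=> [x0 _] cy; apply: mfun_ge => // i; rewrite mul0r. Qed.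

(** This is exp(-h) for the Hilbert projective metric h (0 when h is infinite), so d = tanh(h/2). *)
Definition mprod x y := mfun x y * mfun y x.

Lemma mprod_ge0 x y : cone x -> cone y -> 0 <= mprod x y.
Proof. by move=> cx cy; rewrite mulr_ge0 ?mfun_ge0. Qed.

Lemma mprod_ge x y a b : cone x -> cone y -> 0 <= a -> 0 <= b ->
  (forall i, a * y i 0 <= x i 0) -> (forall i, b * x i 0 <= y i 0) ->
  a * b <= mprod x y.
Proof. by move=> cx cy a0 b0 ax bx; apply: ler_pM => //; exact: mfun_ge. Qed.

(** At a coordinate with x_i > 0, m(x,y) m(y,x) x_i <= m(x,y) y_i <= x_i. *)
Lemma mprod_le1 x y : cone x -> cone y -> mprod x y <= 1.
Proof.
move=> cx cy; have [_ [i xi]] := cx.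
have := mfun_mul_le cy cx i; have /(_ i) := mfun_mul_le cx cy.
rewrite /mprod => h1 h2; rewrite -(ler_pM2r xi) mul1r -mulrA.
by apply: le_trans h1; apply: ler_wpM2l => //; exact: mfun_ge0.
Qed.

Lemma coneZ a x : 0 < a -> cone x -> cone (a *: x).
Proof.
move=> c0 [z0 [i zi]]; split=> [j|]; first by rewrite mxE mulr_ge0// ltW.
by exists i; rewrite mxE mulr_gt0.
Qed.

Lemma mfunZ x y a b : cone x -> cone y -> 0 < a -> 0 < b ->
  mfun (a *: x) (b *: y) = a / b * mfun x y.
Proof.
move=> cx cy a0 b0.
apply/eqP; rewrite eq_le; apply/andP; split; last first.
  apply: mfun_ge; first exact: coneZ.
  move=> i; rewrite !mxE.
  have -> : a / b * mfun x y * (b * y i 0) = a * (mfun x y * y i 0).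
    by field; rewrite gt_eqF.
  by rewrite ler_pM2l// mfun_mul_le.
rewrite -ler_pdivrMl ?divr_gt0//; apply: mfun_ge => // i.
have := mfun_mul_le (coneZ a0 cx) (coneZ b0 cy) i; rewrite !mxE => H.
rewrite -(ler_pM2l a0); apply: le_trans H; rewrite le_eqVlt; apply/orP; left.
by apply/eqP; field; rewrite !gt_eqF.
Qed.

Lemma mprodZ x y a b : cone x -> cone y -> 0 < a -> 0 < b ->
  mprod (a *: x) (b *: y) = mprod x y.
Proof.
by move=> *; rewrite /mprod !mfunZ//; field; rewrite !gt_eqF.
Qed.

(** The map t -> (1 - t)/(1 + t) decreases on [0, 1]. *)
Lemma dist_mono x y x' y' : cone x -> cone y -> cone x' -> cone y' ->
  mprod x y <= mprod x' y' -> dist x' y' <= dist x y.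
Proof.
move=> cx cy cx' cy'; rewrite /dist -!/(mprod _ _).
have := mprod_ge0 cx cy; have := mprod_ge0 cx' cy'.
have := mprod_le1 cx cy; have := mprod_le1 cx' cy'.
move: (mprod x y) (mprod x' y') => t t' *.
rewrite ler_pdivrMr; last by lra.
by rewrite mulrAC ler_pdivlMr; [nra | lra].
Qed.

Lemma dist_ge0 x y : cone x -> cone y -> 0 <= dist x y.
Proof.
move=> cx cy; rewrite /dist -!/(mprod _ _).
have := mprod_ge0 cx cy; have := mprod_le1 cx cy => *.
by rewrite divr_ge0; lra.
Qed.

Lemma dist_le x y : cone x -> cone y -> dist x y <= 1 - mprod x y.
Proof.
move=> cx cy; rewrite /dist -!/(mprod _ _).
have := mprod_ge0 cx cy; have := mprod_le1 cx cy => *.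
by rewrite ler_pdivrMr; [nra | lra].
Qed.

Lemma dist_le1 x y : cone x -> cone y -> dist x y <= 1.
Proof.
by move=> cx cy; apply: (le_trans (dist_le cx cy)); rewrite gerBl mprod_ge0.
Qed.

Lemma l1normE x : (forall i, 0 <= x i 0) -> l1norm x = \sum_i x i 0.
Proof. by move=> x0; apply: eq_bigr => i _; rewrite ger0_norm. Qed.

Lemma l1norm_gt0 x : cone x -> 0 < l1norm x.
Proof.
move=> [x0 [i xi]]; rewrite l1normE// (bigD1 i)//= ltr_pwDl// sumr_ge0//.
Qed.

Lemma Bbar_cone x : Bbar x -> cone x.
Proof.
move=> [x0 nx]; split=> //; apply: contrapT => H.
have : l1norm x = 0.
  rewrite l1normE// big1// => i _; apply/eqP; rewrite eq_le x0 andbT leNgt.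
  by apply/negP => xi; apply: H; exists i.
by rewrite nx => /eqP; rewrite oner_eq0.
Qed.

Lemma normalize_Bbar x : cone x -> Bbar ((l1norm x)^-1 *: x).
Proof.
move=> cx; have n0 := l1norm_gt0 cx; case: (cx) => x0 _.
have Z0 : forall i, 0 <= ((l1norm x)^-1 *: x) i 0.
  by move=> i; rewrite mxE mulr_ge0// invr_ge0 ltW.
split=> //; rewrite l1normE//; under eq_bigr do rewrite mxE.
by rewrite -mulr_sumr -l1normE// mulVf// gt_eqF.
Qed.

(** The column condition in S is what keeps g x from vanishing: the column of a positive x_j
    contains a positive entry. *)
Lemma cone_mul g x : inS g -> cone x -> cone (g *m x).
Proof.
move=> [g0 _ gc] [x0 [j xj]]; split=> [i|].
  by rewrite mxE sumr_ge0// => k _; rewrite mulr_ge0.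
have [i gij] := gc j; exists i; rewrite mxE (bigD1 j)//= ltr_pwDl ?mulr_gt0//.
by rewrite sumr_ge0// => k _; rewrite mulr_ge0.
Qed.

Lemma act_Bbar g x : inS g -> Bbar x -> Bbar (act g x).
Proof. by move=> Sg Bx; exact/normalize_Bbar/cone_mul/Bbar_cone. Qed.

(** A nonnegative matrix preserves the inequality m(u,v) v <= u, so the same constants remain
    admissible for the images. *)
Lemma mprod_mul g x y : inS g -> cone x -> cone y ->
  mprod x y <= mprod (g *m x) (g *m y).
Proof.
move=> Sg cx cy; have [g0 _ _] := Sg.
have H (u v : 'cV[R]_q) : cone u -> cone v -> forall i, mfun u v * (g *m v) i 0 <= (g *m u) i 0.
  move=> cu cv i; rewrite !mxE mulr_sumr ler_sum// => j _.
  by rewrite mulrCA ler_wpM2l// mfun_mul_le.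
apply: mprod_ge; rewrite ?mfun_ge0//; try exact: cone_mul; exact: H.
Qed.

Lemma dist_act g x y : inS g -> Bbar x -> Bbar y ->
  dist (act g x) (act g y) <= dist x y.
Proof.
move=> Sg /Bbar_cone cx /Bbar_cone cy.
have nx := l1norm_gt0 (cone_mul Sg cx); have ny := l1norm_gt0 (cone_mul Sg cy).
apply: dist_mono => //; rewrite /act.
- by apply: coneZ; rewrite ?invr_gt0//; exact: cone_mul.
- by apply: coneZ; rewrite ?invr_gt0//; exact: cone_mul.
by rewrite mprodZ ?invr_gt0 ?mprod_mul//; exact: cone_mul.
Qed.

(** Summing m(u,v) v_i <= u_i over the simplex gives m <= 1. If d = 0 the product is 1, so both
    factors are 1 and the coordinatewise inequalities hold in both directions. *)
Lemma dist_gt0 x y : Bbar x -> Bbar y -> x <> y -> 0 < dist x y.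
Proof.
move=> Bx By xy; have cx := Bbar_cone Bx; have cy := Bbar_cone By.
rewrite lt_neqAle dist_ge0// andbT; apply/eqP => /esym d0; apply: xy.
have [t0 t1] := (mprod_ge0 cx cy, mprod_le1 cx cy).
have t_eq1 : mprod x y = 1.
  move/eqP: d0; rewrite /dist -!/(mprod _ _) mulf_eq0 invr_eq0 => /orP[] /eqP; lra.
have sumE (z : 'cV[R]_q) : Bbar z -> \sum_i z i 0 = 1.
  by move=> [z0 <-]; rewrite l1normE.
have m_le1 (u v : 'cV[R]_q) : Bbar u -> Bbar v -> mfun u v <= 1.
  move=> Bu Bv; rewrite -(mulr1 (mfun u v)) -{1}(sumE _ Bv) -(sumE _ Bu) mulr_sumr.
  by apply: ler_sum => i _; apply: mfun_mul_le; exact: Bbar_cone.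
have := m_le1 _ _ Bx By; have := m_le1 _ _ By Bx.
have := mfun_ge0 cx cy; have := mfun_ge0 cy cx.
move: t_eq1; rewrite /mprod => t_eq1 *.
have m1 : mfun x y = 1 by nra.
have m2 : mfun y x = 1 by nra.
apply/colP => i; apply/eqP; rewrite eq_le.
have := mfun_mul_le cx cy i; have := mfun_mul_le cy cx i.
by rewrite m1 m2 !mul1r => -> ->.
Qed.

Lemma inS1 : inS (1%:M : 'M[R]_q).
Proof.
by split=> i; [move=> j; rewrite mxE ler0n|exists i; rewrite mxE eqxx ltr01|
  exists i; rewrite mxE eqxx ltr01].
Qed.

Lemma inS_tr g : inS g -> inS g^T.
Proof.
by move=> [g0 gr gc]; split=> i; [move=> j; rewrite mxE|have [j] := gc i|have [j] := gr i];
  rewrite ?mxE//; exists j; rewrite mxE.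
Qed.

Lemma inS_mul g h : inS g -> inS h -> inS (g *m h).
Proof.
move=> [g0 gr gc] [h0 hr hc].
have ge0 i j k : 0 <= g i k * h k j by rewrite mulr_ge0.
split=> [i j|i|j]; first by rewrite mxE sumr_ge0.
- have [k gik] := gr i; have [j hkj] := hr k; exists j.
  by rewrite mxE (bigD1 k)//= ltr_pwDl ?mulr_gt0 ?sumr_ge0.
- have [k hkj] := hc j; have [i gik] := gc k; exists i.
  by rewrite mxE (bigD1 k)//= ltr_pwDl ?mulr_gt0 ?sumr_ge0.
Qed.

Lemma l1normZ a x : 0 <= a -> l1norm (a *: x) = a * l1norm x.
Proof.
move=> a0; rewrite /l1norm mulr_sumr; apply: eq_bigr => i _.
by rewrite mxE normrM ger0_norm.
Qed.

Lemma act_mul g h x : inS g -> inS h -> Bbar x -> act (g *m h) x = act g (act h x).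
Proof.
move=> Sg Sh /Bbar_cone cx; have ch := cone_mul Sh cx.
have n1 := l1norm_gt0 ch; have n2 := l1norm_gt0 (cone_mul Sg ch).
rewrite /act -scalemxAr l1normZ ?invr_ge0 ?ltW// scalerA -mulmxA; congr (_ *: _).
by field; rewrite !gt_eqF.
Qed.

Lemma act1 x : Bbar x -> act 1%:M x = x.
Proof. by move=> [_ nx]; rewrite /act mul1mx nx invr1 scale1r. Qed.

End Geometry.

(** * Borel measurability of matrix functions *)

Section MeasurableMatrices.
Variable R : realType.

Lemma measurable_coord m n i j :
  measurable_fun setT (fun M : g_sigma_algebraType (@mxgen R m n) =>
    (M : 'M[R]_(m, n)) i j).
Proof.
move=> _ B mB; rewrite setTI; apply: sub_sigma_algebra.
by exists i, j, B.
Qed.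

Section param.
Context d (T : measurableType d).

Lemma measurable_mx m n (f : T -> g_sigma_algebraType (@mxgen R m n)) :
  (forall i j, measurable_fun setT (fun t => (f t : 'M[R]_(m, n)) i j)) ->
  measurable_fun setT f.
Proof.
move=> mf; apply: (@measurability _ _ _ _ setT f (@mxgen R m n)) => //.
move=> _ [_ [i [j [B [mB ->]]]] <-].
by have := mf i j measurableT B mB.
Qed.

Lemma measurable_mx_coord m n (f : T -> g_sigma_algebraType (@mxgen R m n)) i j :
  measurable_fun setT f ->
  measurable_fun setT (fun t => (f t : 'M[R]_(m, n)) i j).
Proof. by move=> mf; apply: measurableT_comp (measurable_coord i j) mf. Qed.

(** Writing 1/f as f times the power -1 of f^2 leaves a nonnegative base for [powR], and agrees with
    the convention that the inverse of 0 is 0. *)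
Lemma measurable_fun_inv (f : T -> R) :
  measurable_fun setT f -> measurable_fun setT (fun t => (f t)^-1).
Proof.
move=> mf; rewrite (_ : (fun t => _) = (fun t => f t * (f t * f t) `^ (- 1))).
  apply: measurable_funM => //.
  exact: (measurableT_comp (measurable_powR (-1)) (measurable_funM mf mf)).
apply/funext => t; rewrite powR_inv1; last by rewrite -expr2 sqr_ge0.
have [->|f0] := eqVneq (f t) 0; first by rewrite invr0 mul0r.
by field.
Qed.

Lemma measurable_mulmx m n p (f : T -> 'M[R]_(m, n)) (g : T -> 'M[R]_(n, p)) :
  (forall i j, measurable_fun setT (fun t => f t i j)) ->
  (forall i j, measurable_fun setT (fun t => g t i j)) ->
  forall i j, measurable_fun setT (fun t => (f t *m g t) i j).
Proof.
move=> mf mg i j; under eq_fun do rewrite mxE.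
by apply: measurable_sum => k; exact: measurable_funM.
Qed.

Variable q : nat.
Implicit Types x y : T -> 'cV[R]_q.

Lemma measurable_l1norm x : (forall i j, measurable_fun setT (fun t => x t i j)) ->
  measurable_fun setT (fun t => l1norm (x t)).
Proof.
move=> mx; apply: measurable_sum => i.
by apply: measurableT_comp => //; exact: mx.
Qed.

Lemma measurable_act (g : T -> 'M[R]_q) x :
  (forall i j, measurable_fun setT (fun t => g t i j)) ->
  (forall i j, measurable_fun setT (fun t => x t i j)) ->
  forall i j, measurable_fun setT (fun t => act (g t) (x t) i j).
Proof.
move=> mg mx i j; under eq_fun do rewrite mxE.
apply: measurable_funM; last exact: measurable_mulmx.
by apply/measurable_fun_inv/measurable_l1norm => k l; exact: measurable_mulmx.
Qed.

Lemma measurable_bigmin (I : Type) (s : seq I) (F : I -> T -> \bar R) :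
  (forall i, measurable_fun setT (F i)) ->
  measurable_fun setT (fun t => \big[Order.min/+oo%E]_(i <- s) F i t).
Proof.
move=> mF; elim: s => [|i s IH].
  by under eq_fun do rewrite big_nil; exact: measurable_cst.
by under eq_fun do rewrite big_cons; exact: measurable_mine.
Qed.

Lemma measurable_mfun x y : (forall i j, measurable_fun setT (fun t => x t i j)) ->
  (forall i j, measurable_fun setT (fun t => y t i j)) ->
  measurable_fun setT (fun t => mfun (x t) (y t)).
Proof.
move=> mx my; apply: (measurableT_comp (fine_measurable measurableT)).
(* The index set {i : y_i > 0} varies with t; it is moved into the terms, with the neutral value
   [+oo] off it. *)
under eq_fun do rewrite big_mkcond.
apply: measurable_bigmin => i; apply: measurable_fun_ifT.
- apply: measurable_fun_ltr; [exact: measurable_cst|exact: my].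
- apply/measurable_EFinP/measurable_funM; first exact: mx.
  exact: measurable_fun_inv.
- exact: measurable_cst.
Qed.

Lemma measurable_dist x y : (forall i j, measurable_fun setT (fun t => x t i j)) ->
  (forall i j, measurable_fun setT (fun t => y t i j)) ->
  measurable_fun setT (fun t => dist (x t) (y t)).
Proof.
move=> mx my.
have mp : measurable_fun setT (fun t => mfun (x t) (y t) * mfun (y t) (x t)).
  by apply: measurable_funM; exact: measurable_mfun.
apply: measurable_funM; first exact: measurable_funB.
by apply: measurable_fun_inv; exact: measurable_funD.
Qed.

End param.

Lemma measurable_Bbar q : measurable (@Bbar R q : set (VecT R q)).
Proof.
have -> : (@Bbar R q : set (VecT R q)) =
    \bigcap_(i in [set: 'I_q]) [set x : VecT R q | 0 <= (x : 'cV[R]_q) i 0] `&`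
    [set x : VecT R q | l1norm (x : 'cV[R]_q) = 1].
  apply/seteqP; split=> [x [x0 nx]|x [x0 nx]]; split=> //.
  - by move=> i _; exact: x0.
  - by move=> i; exact: x0.
apply: measurableI.
- apply: fin_bigcap_measurable => // i _.
  rewrite -[X in measurable X]setTI.
  rewrite (_ : [set x | _] = (fun x : VecT R q => (x : 'cV[R]_q) i 0) @^-1` `[0, +oo[).
    by apply: measurable_coord => //; exact: measurable_itv.
  by apply/seteqP; split=> x /=; rewrite in_itv/= andbT.
- rewrite -[X in measurable X]setTI.
  rewrite (_ : [set x | _] = (fun x : VecT R q => l1norm (x : 'cV[R]_q)) @^-1` [set 1]) //.
  by apply: measurable_l1norm => // i j; exact: measurable_coord.
Qed.

Lemma measurable_inS q : measurable (@inS R q : set (MatT R q)).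
Proof.
have mp (i j : 'I_q) : measurable [set g : MatT R q | 0 < (g : 'M[R]_q) i j].
  rewrite -[X in measurable X]setTI.
  rewrite (_ : [set x | _] = (fun x : MatT R q => (x : 'M[R]_q) i j) @^-1` `]0, +oo[).
    by apply: measurable_coord => //; exact: measurable_itv.
  by apply/seteqP; split=> x /=; rewrite in_itv/= andbT.
have mn (i j : 'I_q) : measurable [set g : MatT R q | 0 <= (g : 'M[R]_q) i j].
  rewrite -[X in measurable X]setTI.
  rewrite (_ : [set x | _] = (fun x : MatT R q => (x : 'M[R]_q) i j) @^-1` `[0, +oo[).
    by apply: measurable_coord => //; exact: measurable_itv.
  by apply/seteqP; split=> x /=; rewrite in_itv/= andbT.
have -> : (@inS R q : set (MatT R q)) =
    (\bigcap_(i in [set: 'I_q]) \bigcap_(j in [set: 'I_q])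
       [set g : MatT R q | 0 <= (g : 'M[R]_q) i j]) `&`
    (\bigcap_(i in [set: 'I_q]) \bigcup_(j in [set: 'I_q])
       [set g : MatT R q | 0 < (g : 'M[R]_q) i j]) `&`
    (\bigcap_(j in [set: 'I_q]) \bigcup_(i in [set: 'I_q])
       [set g : MatT R q | 0 < (g : 'M[R]_q) i j]).
  apply/seteqP; split=> [g [g0 gr gc]|g [[g0 gr] gc]].
    split; [split=> i _ |move=> i _].
    - by move=> j _; exact: g0.
    - by have [j] := gr i; exists j.
    - by have [j] := gc i; exists j.
  split=> [i j|i|i]; first exact: g0.
  - by have [j _] := gr i I; exists j.
  - by have [j _] := gc i I; exists j.
by apply: measurableI; [apply: measurableI|];
  apply: fin_bigcap_measurable => // i _;
  [apply: fin_bigcap_measurable|apply: fin_bigcup_measurable|apply: fin_bigcup_measurable].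
Qed.

(** Normalised rational vectors, enumerated by [unpickle]. Some indices give points off the simplex;
    users filter by [Bbar (rat_point q n)]. *)
Definition rat_point q (n : nat) : 'cV[R]_q :=
  let y := map_mx (@ratr R) (odflt 0 (unpickle n : option 'cV[rat]_q)) in
  (l1norm y)^-1 *: y.

(** Density is for d, which separates faces, so the approximant must vanish exactly where x does.
    Rationals between x_i and (1 + e) x_i achieve this, and give m(x,y) m(y,x) >= 1/(1 + e) >= 1 -
    e. *)
Lemma rat_point_dense q (x : 'cV[R]_q) (e : R) : Bbar x -> 0 < e ->
  exists2 n, Bbar (rat_point q n) & dist x (rat_point q n) <= e.
Proof.
move=> Bx e0; have cx := Bbar_cone Bx; have [x0 [k xk]] := cx.
have /choice[z Hz] : forall i : 'I_q, exists r : rat,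
    x i 0 <= ratr r <= (1 + e) * x i 0.
  move=> i; have := x0 i; rewrite le_eqVlt => /orP[/eqP <-|xi].
    by exists 0; rewrite raddf0 mulr0 lexx.
  have /rat_in_itvoo[r] : x i 0 < (1 + e) * x i 0 by rewrite ltr_pMl// ltrDl.
  by rewrite in_itv/= => /andP[h1 h2]; exists r; rewrite !ltW.
pose y := map_mx (@ratr R) (\col_i z i).
have xy i : x i 0 <= y i 0 by rewrite !mxE; case/andP: (Hz i).
have yx i : y i 0 <= (1 + e) * x i 0 by rewrite !mxE; case/andP: (Hz i).
have cy : cone y.
  by split=> [i|]; [exact: le_trans (xy i)|exists k; exact: lt_le_trans (xy k)].
exists (pickle (\col_i z i)); rewrite /rat_point pickleK/= -/y.
  exact: normalize_Bbar.
have ny := l1norm_gt0 cy.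
have cy' : cone ((l1norm y)^-1 *: y) by apply: coneZ => //; rewrite invr_gt0.
apply: (le_trans (dist_le cx cy')).
rewrite -[x in mprod x]scale1r mprodZ ?invr_gt0//.
have e1 : 0 < 1 + e by rewrite addr_gt0.
have : (1 + e)^-1 * 1 <= mprod x y.
  apply: mprod_ge => //; first by rewrite invr_ge0 ltW.
  - by move=> i; rewrite ler_pdivrMl.
  - by move=> i; rewrite mul1r.
have : 1 - e <= (1 + e)^-1 by rewrite -[leRHS]mul1r ler_pdivlMr//; nra.
lra.
Qed.

(* [u] is the upper envelope of the countably many measurable functions
   [u y - L * dist x y], with [y] in a [dist]-dense sequence. *)
Lemma measurable_lipschitz q (u : 'cV[R]_q -> R) (L : R) : 0 <= L ->
  (forall x y, Bbar x -> Bbar y -> `|u x - u y| <= L * dist x y) ->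
  measurable_fun (@Bbar R q : set (VecT R q)) u.
Proof.
move=> L0 uL.
apply: (measurability _ (RGenOInfty.measurableE R)).
move=> _ [_ [a ->] <-].
have -> : @Bbar R q `&` u @^-1` `]a, +oo[ =
    \bigcup_(n in [set n | Bbar (rat_point q n)])
      (@Bbar R q `&` [set x | a < u (rat_point q n) - L * dist x (rat_point q n)]).
  apply/seteqP; split=> x /=.
    rewrite in_itv/= andbT => -[Bx ax].
    (* At distance at most this tolerance, L d is lost twice: once from u x to u y, once in the
       envelope. The extra 1 gives strictness when d > 0 and covers L = 0. *)
    have e0 : 0 < (u x - a) / (2 * L + 1).
      by rewrite divr_gt0 ?subr_gt0// ltr_wpDl// mulr_ge0.
    have [n Bn dn] := rat_point_dense Bx e0; exists n => //; split=> //=.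
    have := uL _ _ Bx Bn; rewrite ler_norml => /andP[_ h].
    move: dn; rewrite ler_pdivlMr; last by rewrite ltr_wpDl// mulr_ge0.
    have := dist_ge0 (Bbar_cone Bx) (Bbar_cone Bn); move: h ax.
    move: (u x) (u (rat_point q n)) (dist x (rat_point q n)) => ux uy dxy h ax.
    rewrite le_eqVlt => /predU1P[d0|d0] dn; first by move: h; rewrite -d0 !mulr0 => h; lra.
    move: h dn; rewrite mulrDr mulr1 mulrCA [dxy * L]mulrC.
    by move: (L * dxy) => Ld *; lra.
  move=> [n Bn [Bx ax]]; split=> //; rewrite in_itv/= andbT.
  have := uL _ _ Bx Bn; rewrite ler_norml => /andP[]; move: ax => /=.
  by move: (L * _) => Ld *; lra.
apply: bigcup_measurable => n _; apply: measurableI; first exact: measurable_Bbar.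
rewrite -[X in measurable X]setTI.
rewrite (_ : [set x | _] = (fun x : VecT R q =>
   u (rat_point q n) - L * dist x (rat_point q n)) @^-1` `]a, +oo[); last first.
  by apply/seteqP; split=> x /=; rewrite in_itv/= andbT.
suff mfu : measurable_fun setT (fun x : VecT R q =>
   u (rat_point q n) - L * dist x (rat_point q n)).
  by apply: mfu => //; exact: measurable_itv.
apply: measurable_funB => //; apply: measurable_funM => //.
by apply: measurable_dist => i j //; exact: measurable_coord.
Qed.

End MeasurableMatrices.

(** * Integrals against probability measures *)

Section FullMeasure.
Context d (T : measurableType d) (R : realType) (P : probability T R).
Implicit Types f g : T -> R.

Lemma measureI_full (D A : set T) : measurable D -> P D = 1%E -> measurable A ->
  P (A `&` D) = P A.
Proof.
move=> mD PD mA.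
have Z : P (A `\` D) = 0%E.
  apply/eqP; rewrite eq_le measure_ge0 andbT.
  apply: (@le_trans _ _ (P (~` D))).
    by apply: le_measure; rewrite ?inE//; [exact: measurableD|exact: measurableC].
  by rewrite probability_setC// PD subee.
by rewrite [RHS](measureDI _ mA mD) [X in (X + _)%E]Z add0e.
Qed.

Import HBNNSimple.

(** Cutting h off D changes nonzero level sets by null sets only; the level 0 may grow, but it has
    weight 0. *)
Lemma sintegral_full (D : set T) (mD : measurable D) (h : {nnsfun T >-> R}) :
  P D = 1%E -> sintegral P h = sintegral P (proj_nnsfun h mD).
Proof.
move=> PD; apply: eq_fsbigr => r _.
have [->|r0] := eqVneq r 0; first by rewrite !mul0e.
rewrite -(measureI_full mD PD); last exact: measurable_funPTI.
congr (_ * P _)%E; apply/seteqP; split=> x /=.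
  by move=> [hx Dx]; rewrite mindicE mem_set// mulr1.
have [xD|xD] := pselect (D x).
  by rewrite mindicE mem_set// mulr1.
by rewrite mindicE memNset// mulr0 => /esym/eqP; rewrite (negbTE r0).
Qed.

(* No measurability is required of the integrands: the integral is a supremum
   over simple functions, and a simple function may be cut off outside [D]. *)
Lemma integral_full (D : set T) (f g : T -> \bar R) : measurable D -> P D = 1%E ->
  (forall x, D x -> f x = g x) ->
  (\int[P]_x f x = \int[P]_x g x)%E.
Proof.
move=> mD PD.
suff H (f1 f2 : T -> \bar R) : (forall x, 0 <= f2 x)%E ->
    (forall x, D x -> f1 x = f2 x) ->
    (ereal_sup [set sintegral P h | h in [set h : {nnsfun T >-> R} |
       forall x, ((h x)%:E <= f1 x)%E]] <=
     ereal_sup [set sintegral P h | h in [set h : {nnsfun T >-> R} |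
       forall x, ((h x)%:E <= f2 x)%E]])%E.
  move=> fg; rewrite /integral !patch_setT; congr (_ - _)%E.
  - apply/eqP; rewrite eq_le; apply/andP; split; apply: H => [x|x Dx].
    + exact: funepos_ge0.
    + by rewrite !funeposE fg.
    + exact: funepos_ge0.
    + by rewrite !funeposE fg.
  - apply/eqP; rewrite eq_le; apply/andP; split; apply: H => [x|x Dx].
    + exact: funeneg_ge0.
    + by rewrite !funenegE fg.
    + exact: funeneg_ge0.
    + by rewrite !funenegE fg.
move=> f20 f12; apply: ge_ereal_sup => _ [h /= hf1 <-].
apply: ereal_sup_ubound; exists (proj_nnsfun h mD); last by rewrite -sintegral_full.
move=> x /=; have [xD|xD] := pselect (D x).
  by rewrite mindicE mem_set// mulr1 -f12.
by rewrite mindicE memNset// mulr0.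
Qed.

Lemma Rintegral_full (D : set T) f g : measurable D -> P D = 1%E ->
  (forall x, D x -> f x = g x) -> \int[P]_x f x = \int[P]_x g x.
Proof.
move=> mD PD fg; congr fine; apply: (integral_full mD PD) => x Dx.
by rewrite fg.
Qed.

Lemma Rintegral_fullT (D : set T) f : measurable D -> P D = 1%E ->
  \int[P]_(x in D) f x = \int[P]_x f x.
Proof.
move=> mD PD; rewrite Rintegral_mkcond.
by apply: (Rintegral_full mD PD) => x Dx; rewrite patchE mem_set.
Qed.

End FullMeasure.

Section BoundedFunctions.
Context d (T : measurableType d) (R : realType) (P : probability T R).
Implicit Types f g : T -> R.

Lemma bounded_integrable f (M : R) : measurable_fun setT f ->
  (forall x, `|f x| <= M) -> P.-integrable setT (EFin \o f).
Proof.
move=> mf fM; apply: measurable_bounded_integrable => //.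
  by apply: (@le_lt_trans _ _ 1%E); rewrite ?ltry// -(probability_setT P).
exists M; split; first exact: num_real.
by move=> N MN x _ /=; apply: le_trans (fM x) (ltW MN).
Qed.

Lemma Rintegral_le f g (M : R) : measurable_fun setT f -> measurable_fun setT g ->
  (forall x, `|f x| <= M) -> (forall x, `|g x| <= M) ->
  (forall x, f x <= g x) -> \int[P]_x f x <= \int[P]_x g x.
Proof.
by move=> mf mg fM gM fg; apply: le_Rintegral => //; exact: bounded_integrable.
Qed.

Lemma Rintegral_bound f (M : R) : measurable_fun setT f ->
  (forall x, `|f x| <= M) -> `|\int[P]_x f x| <= M.
Proof.
move=> mf fM.
apply: (le_trans (le_normr_Rintegral _ (bounded_integrable mf fM))) => //.
have -> : M = \int[P]_x (cst M x).
  by rewrite Rintegral_cst// [X in fine X]probability_setT mulr1.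
apply: (@Rintegral_le _ _ M) => //.
- by apply: measurableT_comp.
- by move=> x; rewrite normr_id.
by move=> x /=; rewrite ger0_norm// (le_trans _ (fM x)).
Qed.

End BoundedFunctions.

Section Fubini.
Context d1 d2 (T1 : measurableType d1) (T2 : measurableType d2) (R : realType).
Variables (P1 : probability T1 R) (P2 : probability T2 R) (M : R).
Variable f : T1 * T2 -> R.
Hypothesis mf : measurable_fun setT f.
Hypothesis fM : forall x, `|f x| <= M.

Lemma integrable_product : (P1 \x P2)%E.-integrable setT (EFin \o f).
Proof. exact: (@bounded_integrable _ _ _ (P1 \x P2)%E f M). Qed.

Lemma EFin_inner x : (\int[P2]_y (f (x, y))%:E = (\int[P2]_y f (x, y))%:E)%E.
Proof.
rewrite /Rintegral fineK//; apply: integrable_fin_num => //.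
apply: (@bounded_integrable _ _ _ _ _ M) => [|y]; last exact: fM.
exact: measurableT_comp.
Qed.

Lemma measurable_inner : measurable_fun setT (fun x => \int[P2]_y f (x, y)).
Proof.
apply/measurable_EFinP.
rewrite (_ : EFin \o _ = fun x => (\int[P2]_y (EFin \o f) (x, y))%E).
  by apply: measurable_fubini_F; exact: integrable_product.
by apply/funext => x /=; rewrite EFin_inner.
Qed.

Lemma Rintegral_product :
  \int[P1]_x \int[P2]_y f (x, y) = fine (\int[P1 \x P2]_z (f z)%:E)%E.
Proof.
rewrite -(integral12_prod_meas1 integrable_product).
by congr fine; apply: eq_integral => x _; rewrite -EFin_inner.
Qed.

End Fubini.

(** * Laws and independence *)

Section Laws.
Context d d' (T : measurableType d) (T' : measurableType d') (R : realType).

Definition mfun_of (f : T -> T') (mf : measurable_fun setT f) : {mfun T >-> T'} :=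
  HB.pack f (isMeasurableFun.Build _ _ _ _ f mf).

Lemma Rintegral_law (P : probability T R) (Q : probability T' R) (f : T -> T')
    (phi : T' -> R) (M : R) : measurable_fun setT f ->
  (forall A, measurable A -> Q A = P (f @^-1` A)) ->
  measurable_fun setT phi -> (forall y, `|phi y| <= M) ->
  \int[Q]_y phi y = \int[P]_x phi (f x).
Proof.
move=> mf QE mphi phiM; congr fine.
rewrite (@eq_measure_integral _ _ _ setT (distribution P (mfun_of mf))).
  rewrite integral_distribution//; first exact/measurable_EFinP.
  apply: (@bounded_integrable _ _ _ P (fun x => phi (f x)) M) => //.
  exact: (measurableT_comp mphi mf).
by move=> A mA _; exact: QE.
Qed.

End Laws.

Section Independence.
Context d d1 d2 (T : measurableType d) (T1 : measurableType d1)
  (T2 : measurableType d2) (R : realType) (P : probability T R).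
Variables (U : T -> T1) (V : T -> T2).
Hypotheses (mU : measurable_fun setT U) (mV : measurable_fun setT V).

(** Factorisation on rectangles identifies the joint law with the product of the marginals; Fubini
    then separates the variables. *)
Lemma Rintegral_indep (h : T1 * T2 -> R) (M : R) :
  (forall A B, measurable A -> measurable B ->
     P (U @^-1` A `&` V @^-1` B) = (P (U @^-1` A) * P (V @^-1` B))%E) ->
  measurable_fun setT h -> (forall z, `|h z| <= M) ->
  \int[P]_w h (U w, V w) = \int[P]_w \int[P]_w' h (U w, V w').
Proof.
move=> indep mh hM.
have mUV : measurable_fun setT (fun w => (U w, V w)) by exact: measurable_fun_pair.
rewrite -(@Rintegral_law _ _ _ _ _ P (distribution P (mfun_of mUV)) _ h M mUV) //.
transitivity (\int[distribution P (mfun_of mU)]_x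
  \int[distribution P (mfun_of mV)]_y h (x, y)).
  rewrite (@Rintegral_product _ _ _ _ _ _ _ M)//; congr fine.
  apply: eq_measure_integral => A mA _; apply/esym.
  by apply: product_measure_unique => // A1 A2 mA1 mA2; exact: indep.
rewrite (@Rintegral_law _ _ _ _ _ P _ U _ M)//.
- apply: eq_Rintegral => w _; rewrite (@Rintegral_law _ _ _ _ _ P _ V _ M)//.
  exact: measurableT_comp.
- exact: (@measurable_inner _ _ _ _ _ (distribution P (mfun_of mU)) _ M).
move=> x; apply: Rintegral_bound => //; exact: measurableT_comp.
Qed.

(* The events [(U, V) \in A `*` B] form a pi-system. *)
Lemma indep_event_pair (E : set T) (mE : measurable E) :
  (forall A B, measurable A -> measurable B ->
     P (U @^-1` A `&` V @^-1` B `&` E) = (P (U @^-1` A `&` V @^-1` B) * P E)%E) ->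
  forall C : set (T1 * T2), measurable C ->
  P ((fun w => (U w, V w)) @^-1` C `&` E) = (P ((fun w => (U w, V w)) @^-1` C) * P E)%E.
Proof.
move=> H C mC.
have mUV : measurable_fun setT (fun w => (U w, V w)) by exact: measurable_fun_pair.
have PEfin : P E \is a fin_num by exact: fin_num_measure.
have PE0 : 0 <= fine (P E) by rewrite fine_ge0.
(* Both sides are finite measures in C, equal on rectangles; [m2] is the joint law scaled by the
   real number P(E). *)
pose m1 := measure_function_pushforward__canonical__measure_function_Measure
  (mrestr P mE) mUV.
pose m2 := mscale (NngNum PE0) (distribution P (mfun_of mUV)).
suff : m1 C = m2 C.
  by rewrite /m1 /m2 /= /mscale /= /pushforward /mrestr /= fineK// muleC.
apply: (measure_unique [set A `*` B | A in measurable & B in measurable]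
  (fun=> setT)) => //.
- exact: measurable_prod_measurableType.
- move=> _ _ [A1 mA1 [B1 mB1 <-]] [A2 mA2 [B2 mB2 <-]].
  rewrite -setXI; exists (A1 `&` A2); first exact: measurableI.
  by exists (B1 `&` B2) => //; exact: measurableI.
- by move=> _; exists setT => //; exists setT => //; rewrite setXTT.
- by rewrite bigcup_const//; exists 0%N.
- move=> _ [A mA [B mB <-]].
  by rewrite /m1 /m2 /= /mscale /= /pushforward /mrestr /= fineK// muleC; exact: H.
- move=> _; rewrite /m1 /= /pushforward /mrestr preimage_setT setTI.
  by rewrite ltey_eq PEfin.
Qed.

End Independence.

(** * Random products *)

Section RandomProducts.
Context (R : realType) (q : nat) d (Omega : measurableType d).
Variables (Pr : probability Omega R) (X : nat -> Omega -> 'M[R]_q).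
Hypothesis iidX : iid_mx Pr X.

Lemma iid_measurable n : measurable_fun setT (X n : Omega -> MatT R q).
Proof. by have [mX _ _] := iidX; apply: measurable_mx => i j; exact: mX. Qed.

Lemma Yprod0 w : Yprod X 0 w = 1%:M. Proof. by []. Qed.

(** [foldr] exposes Y_1; the inductions need the newest factor, which sits on the right and is
    independent of the rest. *)
Lemma YprodS n w : Yprod X n.+1 w = Yprod X n w *m (X n w)^T.
Proof.
rewrite /Yprod -addn1 iotaD add0n foldr_cat /= mulmx1.
elim: (iota 0 n) => [|k s IH] /=; first by rewrite mul1mx.
by rewrite IH mulmxA.
Qed.

Lemma measurable_tr d' (T : measurableType d') (f : T -> MatT R q) :
  measurable_fun setT f -> measurable_fun setT (fun t => (f t : 'M[R]_q)^T : MatT R q).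
Proof.
move=> mf; apply: measurable_mx => i j; under eq_fun do rewrite mxE.
exact: measurable_mx_coord.
Qed.

Lemma measurable_mul d' (T : measurableType d') (f g : T -> MatT R q) :
  measurable_fun setT f -> measurable_fun setT g ->
  measurable_fun setT (fun t => (f t : 'M[R]_q) *m (g t : 'M[R]_q) : MatT R q).
Proof.
move=> mf mg; apply: measurable_mx => i j.
by apply: measurable_mulmx => k l; exact: measurable_mx_coord.
Qed.

Lemma measurable_Yprod n : measurable_fun setT (Yprod X n : Omega -> MatT R q).
Proof.
elim: n => [|n IH]; first exact: measurable_cst.
rewrite (_ : Yprod X n.+1 = fun w => Yprod X n w *m (X n w)^T).
  by apply: measurable_mul => //; apply: measurable_tr; exact: iid_measurable.
by apply/funext => w; exact: YprodS.
Qed.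

Local Notation cyl s B := (\bigcap_(k in [set k : nat | k \in s]) (X k @^-1` B k)).

Lemma measurable_cyl (s : seq nat) (B : nat -> set (MatT R q)) :
  (forall k, measurable (B k)) -> measurable (cyl s B : set Omega).
Proof.
move=> mB; apply: bigcap_measurableType => k _.
by rewrite -[X in measurable X]setTI; exact: (iid_measurable k).
Qed.

(** The induction moves X_n out of the product and into the cylinder, so the statement must allow
    any finite family of indices at least n, rather than X_n alone. *)
Lemma Yprod_indep_cyl n (A : set (MatT R q)) (s : seq nat) (B : nat -> set (MatT R q)) :
  measurable A -> uniq s -> (forall k, k \in s -> (n <= k)%N) ->
  (forall k, measurable (B k)) ->
  Pr (Yprod X n @^-1` A `&` cyl s B) = (Pr (Yprod X n @^-1` A) * Pr (cyl s B))%E.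
Proof.
have [_ _ Xind] := iidX.
elim: n A s B => [|n IH] A s B mA us sn mB.
  have [A1|A1] := pselect (A 1%:M).
    have -> : Yprod X 0 @^-1` A = setT by apply/seteqP; split.
    by rewrite setTI probability_setT mul1e.
  have -> : Yprod X 0 @^-1` A = set0 by apply/seteqP; split.
  by rewrite set0I measure0 mul0e.
have ns : n \notin s by apply/negP => /sn; rewrite ltnn.
have mC : measurable [set z : MatT R q * MatT R q |
    A ((z.1 : 'M[R]_q) *m (z.2 : 'M[R]_q)^T)].
  rewrite -[X in measurable X]setTI.
  have : measurable_fun setT (fun z : MatT R q * MatT R q =>
      (z.1 : 'M[R]_q) *m (z.2 : 'M[R]_q)^T : MatT R q).
    by apply: measurable_mul => //; exact: measurable_tr.
  by move=> mm; exact: mm.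
have YE : Yprod X n.+1 @^-1` A = (fun w => (Yprod X n w : MatT R q, X n w : MatT R q)) @^-1`
    [set z | A ((z.1 : 'M[R]_q) *m (z.2 : 'M[R]_q)^T)].
  by apply/seteqP; split=> w /=; rewrite YprodS.
rewrite YE; apply: (indep_event_pair (measurable_Yprod n) (iid_measurable n)) => //.
  exact: measurable_cyl.
move=> A1 A2 mA1 mA2.
(* Adding the constraint X_n in A2 to the family turns the event into a cylinder over [n :: s], to
   which the induction hypothesis applies. *)
pose B' k := if k == n then A2 else B k.
have mB' k : measurable (B' k) by rewrite /B'; case: ifP.
have cyl1 : X n @^-1` A2 = cyl [:: n] B'.
  apply/seteqP; split=> [w /= h k|w /(_ n)] /=; rewrite /B' inE ?eqxx.
    by move=> /eqP ->; rewrite eqxx.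
  by apply.
have cyls : cyl s B = cyl s B'.
  by apply: eq_bigcapr => k /= ks; rewrite /B'; case: eqP ks => // ->; rewrite (negbTE ns).
have cyl2 : X n @^-1` A2 `&` cyl s B = cyl (n :: s) B'.
  rewrite cyl1 cyls; apply/seteqP; split=> [w [h1 h2] k /=|w h].
    by rewrite inE => /orP[/eqP ->|]; [apply: h1; rewrite /= inE|exact: h2].
  by split=> k /= ks; apply: h; rewrite /= inE; [move: ks; rewrite inE => -> |rewrite ks orbT].
have u2 : uniq (n :: s) by rewrite /= ns.
rewrite -setIA cyl2 cyl1 cyls (IH _ _ _ _ u2)//; last first.
  by move=> k; rewrite inE => /orP[/eqP ->//|/sn/ltnW].
rewrite (IH _ [:: n])//; last by move=> k; rewrite inE => /eqP ->.
by rewrite !Xind// big_cons big_seq1 muleA.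
Qed.

Lemma Yprod_indep n (A B : set (MatT R q)) : measurable A -> measurable B ->
  Pr (X n @^-1` A `&` Yprod X n @^-1` B) = (Pr (X n @^-1` A) * Pr (Yprod X n @^-1` B))%E.
Proof.
move=> mA mB.
have -> : X n @^-1` A = cyl [:: n] (fun=> A).
  apply/seteqP; split=> [w /= h k|w /(_ n)] /=; rewrite inE ?eqxx.
    by move=> /eqP ->.
  by apply.
by rewrite setIC Yprod_indep_cyl// 1?muleC// => k; rewrite inE => /eqP ->.
Qed.

Lemma Rintegral_X n (phi : MatT R q -> R) (M : R) : measurable_fun setT phi ->
  (forall g, `|phi g| <= M) ->
  \int[Pr]_w phi (X n w) = \int[Pr]_w phi (X 0%N w).
Proof.
move=> mphi phiM; have [_ Xid _] := iidX.
rewrite -(@Rintegral_law _ _ _ _ _ Pr (distribution Pr (mfun_of (iid_measurable n))) _ phi M)//.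
- rewrite (@Rintegral_law _ _ _ (MatT R q) _ Pr _ (X 0%N) _ M)//; first exact: iid_measurable.
  by move=> A mA; exact: Xid.
- exact: iid_measurable.
Qed.

(** X_n is independent of the earlier product and has the law of X_0. The separate sample point w'
    makes [X 0] an independent copy, although [X 0] also occurs inside the product. *)
Lemma Rintegral_YprodS n (h : MatT R q -> R) (M : R) : measurable_fun setT h ->
  (forall g, `|h g| <= M) ->
  \int[Pr]_w h (Yprod X n.+1 w) =
  \int[Pr]_w' \int[Pr]_w h (Yprod X n w *m (X 0%N w')^T).
Proof.
move=> mh hM.
pose H (z : MatT R q * MatT R q) := h ((z.2 : 'M[R]_q) *m (z.1 : 'M[R]_q)^T).
have mH : measurable_fun setT H.
  apply: (measurableT_comp mh); apply: measurable_mul => //; exact: measurable_tr.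
transitivity (\int[Pr]_w H (X n w, Yprod X n w)).
  by apply: eq_Rintegral => w _; rewrite YprodS.
transitivity (\int[Pr]_w \int[Pr]_w' H (X n w, Yprod X n w')).
  apply: (Rintegral_indep (iid_measurable n) (measurable_Yprod n) _ mH (M := M)).
  - by move=> A B mA mB; exact: Yprod_indep.
  - by move=> z; exact: hM.
have mH' : measurable_fun setT (fun z : MatT R q * Omega => H (z.1, Yprod X n z.2)).
  apply: (measurableT_comp mH); apply: measurable_fun_pair => //.
  by apply: (measurableT_comp (measurable_Yprod n)).
apply: (@Rintegral_X n (fun g => \int[Pr]_w' H (g, Yprod X n w')) M).
  apply: (@measurable_inner _ _ _ _ _ (distribution Pr (mfun_of (iid_measurable n))) Pr M _ mH').
  by move=> z; exact: hM.
move=> g; apply: Rintegral_bound => [|w]; last exact: hM.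
have mg : measurable_fun setT (fun w => (g, Yprod X n w : MatT R q)).
  by apply: measurable_fun_pair => //; exact: measurable_Yprod.
exact: (measurableT_comp mH mg).
Qed.

End RandomProducts.

(** * Averages along the random product *)

Section BoundedKernels.
Context (R : realType) (q : nat).
Implicit Types (phi psi : 'cV[R]_q -> 'cV[R]_q -> R) (u : 'cV[R]_q -> R).
Local Notation BB := ((@Bbar R q : set (VecT R q)) `*` (@Bbar R q : set (VecT R q))).

(** Both conditions are imposed on pairs of points of the simplex only, as nothing is known of a
    function of L elsewhere. *)
Definition bounded_measurable phi (M : R) := [/\ 0 <= M,
  measurable_fun BB (fun z => phi z.1 z.2) &
  forall x y, Bbar x -> Bbar y -> `|phi x y| <= M].

(** Extension by zero gives a globally bounded measurable function, as Fubini requires. *)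
Definition cut phi : VecT R q * VecT R q -> R := (fun z => phi z.1 z.2) \_ BB.

Lemma measurable_BB : measurable BB.
Proof. by apply: measurableX; exact: measurable_Bbar. Qed.

Lemma cutE phi x y : Bbar x -> Bbar y -> cut phi (x, y) = phi x y.
Proof. by move=> Bx By; rewrite /cut patchE mem_set. Qed.

Lemma measurable_cut phi M : bounded_measurable phi M -> measurable_fun setT (cut phi).
Proof. by move=> [_ mphi _]; exact: (measurable_restrictT _ measurable_BB).1. Qed.

Lemma cut_bound phi M : bounded_measurable phi M -> forall z, `|cut phi z| <= M.
Proof.
move=> [M0 _ phiM] z; rewrite /cut patchE; case: ifPn => [|_]; last by rewrite normr0.
by rewrite inE => -[]; exact: phiM.
Qed.

Lemma bounded_measurable_dist : bounded_measurable (@dist R q) 1.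
Proof.
split=> // [|x y /Bbar_cone cx /Bbar_cone cy].
  apply: measurable_funTS; apply: measurable_dist => i j.
    exact: (measurable_mx_coord _ _ measurable_fst).
  exact: (measurable_mx_coord _ _ measurable_snd).
by rewrite ger0_norm ?dist_ge0 ?dist_le1.
Qed.

Lemma bounded_measurable_fst u M : 0 <= M ->
  measurable_fun (@Bbar R q : set (VecT R q)) u ->
  (forall x, Bbar x -> `|u x| <= M) -> bounded_measurable (fun x _ => u x) M.
Proof.
move=> M0 mu uM; split=> // [|x y Bx _]; last exact: uM.
apply: (@measurable_comp _ _ _ _ _ _ (@Bbar R q : set (VecT R q)) u BB fst) => //.
- exact: measurable_Bbar.
- by move=> _ [z [Bz _] <-].
exact: measurable_funTS measurable_fst.
Qed.

Lemma bounded_measurable_snd u M : 0 <= M ->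
  measurable_fun (@Bbar R q : set (VecT R q)) u ->
  (forall x, Bbar x -> `|u x| <= M) -> bounded_measurable (fun _ y => u y) M.
Proof.
move=> M0 mu uM; split=> // [|x y _ By]; last exact: uM.
apply: (@measurable_comp _ _ _ _ _ _ (@Bbar R q : set (VecT R q)) u BB snd) => //.
- exact: measurable_Bbar.
- by move=> _ [z [_ Bz] <-].
exact: measurable_funTS measurable_snd.
Qed.

Lemma bounded_measurableZ phi M c : 0 <= c -> bounded_measurable phi M ->
  bounded_measurable (fun x y => c * phi x y) (c * M).
Proof.
move=> c0 [M0 mphi phiM]; split=> [||x y Bx By]; first by rewrite mulr_ge0.
- by apply: measurable_funM => //; exact: measurable_cst.
- by rewrite normrM ger0_norm// ler_wpM2l// phiM.
Qed.

Lemma bounded_measurableB phi psi M N : bounded_measurable phi M ->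
  bounded_measurable psi N -> bounded_measurable (fun x y => phi x y - psi x y) (M + N).
Proof.
move=> [M0 mphi phiM] [N0 mpsi psiN]; split=> [||x y Bx By]; first by rewrite addr_ge0.
- exact: measurable_funB.
- by apply: le_trans (ler_normB _ _) _; apply: lerD; [exact: phiM|exact: psiN].
Qed.

End BoundedKernels.

Section Semigroup.
Context (R : realType) (q : nat) d (Omega : measurableType d).
Variables (Pr : probability Omega R) (X : nat -> Omega -> 'M[R]_q).
Hypothesis iidX : iid_mx Pr X.
Hypothesis XS : forall n w, inS (X n w).
Implicit Types (phi psi : 'cV[R]_q -> 'cV[R]_q -> R) (u : 'cV[R]_q -> R).
Local Notation BB := ((@Bbar R q : set (VecT R q)) `*` (@Bbar R q : set (VecT R q))).

(** One random matrix moves both points. For [dist] this is the integral inside c(mu^(n)); for a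
    kernel ignoring y it is P^n. *)
Definition meanY n phi x y :=
  \int[Pr]_w phi (act (Yprod X n w) x) (act (Yprod X n w) y).

Lemma Yprod_inS n w : inS (Yprod X n w).
Proof.
elim: n => [|n IH]; first by rewrite Yprod0; exact: inS1.
by rewrite YprodS; apply: inS_mul => //; exact: inS_tr.
Qed.

Lemma meanY0 phi x y : Bbar x -> Bbar y -> meanY 0 phi x y = phi x y.
Proof.
move=> Bx By; rewrite /meanY; under eq_Rintegral do rewrite Yprod0 !act1//.
by rewrite Rintegral_cst// [X in fine X]probability_setT mulr1.
Qed.

Lemma meanY_cut n phi x y : Bbar x -> Bbar y -> meanY n phi x y =
  \int[Pr]_w cut phi (act (Yprod X n w) x, act (Yprod X n w) y).
Proof.
move=> Bx By; apply: eq_Rintegral => w _.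
by rewrite cutE//; apply: act_Bbar => //; exact: Yprod_inS.
Qed.

Lemma measurable_act_pair d' (T : measurableType d') (g : T -> MatT R q)
    (f : T -> VecT R q * VecT R q) : measurable_fun setT g -> measurable_fun setT f ->
  measurable_fun setT (fun t => (act (g t) (f t).1 : VecT R q, act (g t) (f t).2 : VecT R q)).
Proof.
move=> mg mf.
by apply: measurable_fun_pair; apply: measurable_mx => i j; apply: measurable_act => k l;
  apply: measurable_mx_coord => //; exact: measurableT_comp.
Qed.

Section bounded.
Variables (phi : 'cV[R]_q -> 'cV[R]_q -> R) (M : R).
Hypothesis bphi : bounded_measurable phi M.

Lemma measurable_cut_act n x y : measurable_fun setT (fun w =>
  cut phi (act (Yprod X n w) x, act (Yprod X n w) y)).
Proof.
have mg : measurable_fun setT (fun w : Omega => ((x, y) : VecT R q * VecT R q)).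
  exact: measurable_cst.
exact: (measurableT_comp (measurable_cut bphi)
  (measurable_act_pair (measurable_Yprod iidX n) mg)).
Qed.

Lemma integrable_cut_act n x y : Pr.-integrable setT (EFin \o (fun w =>
  cut phi (act (Yprod X n w) x, act (Yprod X n w) y))).
Proof.
apply: (@bounded_integrable _ _ _ _ _ M); first exact: measurable_cut_act.
by move=> w; exact: cut_bound.
Qed.

Lemma meanY_bounded_measurable n : bounded_measurable (meanY n phi) M.
Proof.
have [M0 _ _] := bphi.
split=> // [|x y Bx By].
  apply: (eq_measurable_fun (fun z : VecT R q * VecT R q =>
    \int[Pr]_w cut phi (act (Yprod X n w) z.1, act (Yprod X n w) z.2))).
    by move=> z; rewrite inE => -[Bx By]; rewrite meanY_cut.
  apply: measurable_funTS.
  have m2 : measurable_fun setT (fun t : VecT R q * VecT R q * Omega =>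
      cut phi (act (Yprod X n t.2) t.1.1, act (Yprod X n t.2) t.1.2)).
    apply: (measurableT_comp (measurable_cut bphi)).
    apply: measurable_act_pair => //.
    exact: (measurableT_comp (measurable_Yprod iidX n) measurable_snd).
  (* [measurable_inner] takes a probability on the parameter space; any one serves, since its
     conclusion does not involve it. *)
  pose P1 := (\d_((0, 0) : VecT R q * VecT R q) : probability _ R).
  by apply: (@measurable_inner _ _ _ _ _ P1 Pr M _ m2) => z; exact: cut_bound.
rewrite meanY_cut//; apply: Rintegral_bound; first exact: measurable_cut_act.
by move=> w; exact: cut_bound.
Qed.

(** Y_1...Y_(n+1).x = (Y_1...Y_n).(Y_(n+1).x): the rightmost factor acts first, and may be replaced
    by an independent copy of Y_1. *)
Lemma meanYS n x y : Bbar x -> Bbar y ->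
  meanY n.+1 phi x y = meanY 1 (meanY n phi) x y.
Proof.
move=> Bx By; rewrite meanY_cut//.
pose h (g : MatT R q) := cut phi (act g x, act g y).
have mh : measurable_fun setT h.
  have mg : measurable_fun setT (fun g : MatT R q => ((x, y) : VecT R q * VecT R q)).
    exact: measurable_cst.
  exact: (measurableT_comp (measurable_cut bphi)
    (@measurable_act_pair _ (MatT R q) id _ (@measurable_id _ _ _) mg)).
rewrite (@Rintegral_YprodS _ _ _ _ _ _ iidX n h M mh); last by move=> g; exact: cut_bound.
apply: eq_Rintegral => w' _; apply: eq_Rintegral => w _.
have S1 := Yprod_inS n w; have S2 := inS_tr (XS 0 w').
by rewrite YprodS Yprod0 mul1mx /h cutE ?act_mul//; do 2 apply: act_Bbar => //.
Qed.

Lemma meanYZ n c x y : Bbar x -> Bbar y ->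
  meanY n (fun x y => c * phi x y) x y = c * meanY n phi x y.
Proof.
move=> Bx By; rewrite (meanY_cut n phi)// -RintegralZl//; last exact: integrable_cut_act.
apply: eq_Rintegral => w _.
by rewrite cutE//; apply: act_Bbar => //; exact: Yprod_inS.
Qed.

End bounded.

Lemma meanYB n phi psi M N x y : bounded_measurable phi M -> bounded_measurable psi N ->
  Bbar x -> Bbar y ->
  meanY n (fun x y => phi x y - psi x y) x y = meanY n phi x y - meanY n psi x y.
Proof.
move=> bphi bpsi Bx By; rewrite (meanY_cut n phi)// (meanY_cut n psi)// -RintegralB//.
- apply: eq_Rintegral => w _.
  by rewrite !cutE//; apply: act_Bbar => //; exact: Yprod_inS.
- exact: integrable_cut_act bphi _ _ _.
- exact: integrable_cut_act bpsi _ _ _.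
Qed.

Lemma meanY_le n phi psi M N x y : bounded_measurable phi M -> bounded_measurable psi N ->
  (forall x y, Bbar x -> Bbar y -> phi x y <= psi x y) ->
  Bbar x -> Bbar y -> meanY n phi x y <= meanY n psi x y.
Proof.
move=> bphi bpsi le_pp Bx By; rewrite !meanY_cut//; apply: le_Rintegral => //.
- exact: integrable_cut_act bphi _ _ _.
- exact: integrable_cut_act bpsi _ _ _.
move=> w _; have S1 := Yprod_inS n w.
by rewrite !cutE//; try exact: act_Bbar; apply: le_pp; exact: act_Bbar.
Qed.

End Semigroup.

(** * Geometric decay of the contraction coefficient *)

Section Fekete.
Variables (R : realType) (a : nat -> R).
Hypotheses (a_ge0 : forall n, 0 <= a n) (a_le1 : forall n, a n <= 1).
Hypothesis a_submul : forall m n, a (m + n)%N <= a m * a n.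

(** Divide n by m: each full block contributes r^m, the remainder contributes at most 1, and the
    prefactor r^(-m) pays for that remainder. *)
Lemma submul_geometric m r : (0 < m)%N -> 0 < r < 1 -> a m <= r ^+ m ->
  forall n, a n <= (r ^+ m)^-1 * r ^+ n.
Proof.
move=> m0 /andP[r0 r1] am n.
have rm0 : 0 < r ^+ m by rewrite exprn_gt0.
have H k s : a (k * m + s)%N <= (r ^+ m) ^+ k.
  elim: k => [|k IH]; first by rewrite mul0n expr0.
  rewrite mulSn -addnA exprS; apply: le_trans (a_submul _ _) _.
  exact: ler_pM.
rewrite ler_pdivlMl// {1}(divn_eq n m).
apply: (@le_trans _ _ (r ^+ m * (r ^+ m) ^+ (n %/ m))).
  by apply: ler_wpM2l (H _ _); exact: ltW.
rewrite -exprS -exprM; apply: ler_wiXn2l; [exact: ltW|exact: ltW|].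
by rewrite mulnC ltnW// ltn_ceil.
Qed.

Local Notation root n := (a n `^ n%:R^-1).

Lemma root_le_exp n r : (0 < n)%N -> 0 <= r -> root n <= r -> a n <= r ^+ n.
Proof.
move=> n0 r0 h; have n1 : n%:R != 0 :> R by rewrite pnatr_eq0 -lt0n.
have -> : a n = root n ^+ n.
  by rewrite -powR_mulrn ?powR_ge0// -powRrM mulVf// powRr1.
by apply: lerXn2r => //; rewrite nnegrE powR_ge0.
Qed.

Lemma cvg_root_const (c : R) : 0 < c -> (fun n => c `^ n%:R^-1) @ \oo --> (1 : R).
Proof.
move=> c0; rewrite -[X in _ --> X]expR0.
rewrite (_ : (fun n => _) = expR \o (fun n => n%:R^-1 * ln c)); last first.
  by apply/funext => n /=; rewrite /powR gt_eqF.
apply: continuous_cvg; first exact: continuous_expR.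
rewrite -[X in _ --> X](mul0r (ln c)); apply: cvgM; last exact: cvg_cst.
rewrite -(cvg_shiftS (fun n => n%:R^-1 : R)).
exact: cvg_harmonic.
Qed.

(** Fekete's lemma in multiplicative form. Convergence itself matters, since [limn] of a divergent
    sequence carries no information. *)
Lemma root_cvg : (fun n => root n) @ \oo --> inf [set root n | n in [set n | (0 < n)%N]].
Proof.
set A := [set root n | n in _].
have lbA : has_lbound A by exists 0 => _ [n _ <-]; exact: powR_ge0.
have A0 : A !=set0 by exists (root 1%N); exists 1%N.
have infA0 : 0 <= inf A by apply: lb_le_inf => // _ [n _ <-]; exact: powR_ge0.
apply/cvgrPdist_lt => e e0.
have [_ [m /= m0 <-] rm] : exists2 x, A x & x < inf A + e / 2.
  by apply: inf_adherent; rewrite ?divr_gt0.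
set r := inf A + e / 2 in rm.
have r0 : 0 < r by rewrite ltr_wpDl// divr_gt0.
have r_le : r <= inf A + e / 2 by [].
suff : \forall n \near \oo, root n < r + e / 2.
  move=> H; near=> n.
  have n0 : (0 < n)%N by near: n; exact: nbhs_infty_gt.
  have : inf A <= root n by apply: ge_inf => //; exists n.
  have : root n < r + e / 2 by near: n.
  rewrite ltr_norml => h1 h2; apply/andP; split; last by lra.
  by rewrite /r in h1; lra.
(* If r >= 1, the bound a n <= 1 is enough; [submul_geometric] needs r < 1. *)
have [r1|r1] := leP 1 r.
  apply: nearW => n; apply: (@le_lt_trans _ _ 1); last first.
    by apply: (le_lt_trans r1); rewrite ltrDl divr_gt0.
  apply: (@le_trans _ _ (1 `^ n%:R^-1)); last by rewrite powR1.
  by apply: ge0_ler_powR; rewrite ?nnegrE ?invr_ge0.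
have am := submul_geometric m0 (introT andP (conj r0 r1)) (root_le_exp m0 (ltW r0) (ltW rm)).
set C := (r ^+ m)^-1 in am.
have C0 : 0 < C by rewrite invr_gt0 exprn_gt0.
have : (fun n => C `^ n%:R^-1 * r) @ \oo --> 1 * r.
  by apply: cvgM; [exact: cvg_root_const|exact: cvg_cst].
rewrite mul1r => /cvgrPdist_lt /(_ (e / 2)) H.
have {}H : \forall n \near \oo, `|r - C `^ n%:R^-1 * r| < e / 2 by apply: H; rewrite divr_gt0.
near=> n.
have n0 : (0 < n)%N by near: n; exact: nbhs_infty_gt.
have n1 : n%:R != 0 :> R by rewrite pnatr_eq0 -lt0n.
have : `|r - C `^ n%:R^-1 * r| < e / 2 by near: n.
rewrite distrC ltr_norml => /andP[_ h].
apply: (@le_lt_trans _ _ (C `^ n%:R^-1 * r)); last by lra.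
have -> : C `^ n%:R^-1 * r = (C * r ^+ n) `^ n%:R^-1.
  rewrite powRM ?exprn_ge0 ?ltW//; congr (_ * _).
  by rewrite -powR_mulrn ?ltW// -powRrM mulfV// powRr1// ltW.
apply: ge0_ler_powR; rewrite ?nnegrE ?invr_ge0//.
by rewrite mulr_ge0 ?exprn_ge0 ?ltW.
Unshelve. all: by end_near. Qed.

(** The limit being an infimum, some m >= 1 has its root below k, and the geometric bound with ratio
    k and C = k^(-m) follows. *)
Lemma root_rate k : limn (fun n => root n) < k < 1 ->
  exists2 C, 0 < C & forall n, a n <= C * k ^+ n.
Proof.
rewrite (cvg_lim _ root_cvg)//.
set A := [set root n | n in _] => /andP[lk k1].
have lbA : has_lbound A by exists 0 => _ [n _ <-]; exact: powR_ge0.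
have A0 : A !=set0 by exists (root 1%N); exists 1%N.
have k0 : 0 < k.
  by apply: le_lt_trans lk; apply: lb_le_inf => // _ [n _ <-]; exact: powR_ge0.
have [_ [m /= m0 <-] rm] : exists2 x, A x & x < k.
  have [x Ax xk] := @inf_adherent _ A (k - inf A) ltac:(by rewrite subr_gt0) (conj A0 lbA).
  by exists x => //; move: xk; rewrite addrC subrK.
exists (k ^+ m)^-1; first by rewrite invr_gt0 exprn_gt0.
apply: submul_geometric => //; first by rewrite k0.
by apply: root_le_exp => //; exact: ltW.
Qed.

End Fekete.

(** * The coefficients c(mu^(n)) as a submultiplicative sequence in [0, 1] *)

Section Coefficient.
Context (R : realType) (q : nat) d (Omega : measurableType d).
Variables (Pr : probability Omega R) (X : nat -> Omega -> 'M[R]_q).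
Hypothesis iidX : iid_mx Pr X.
Hypothesis XS : forall n w, inS (X n w).

Definition coef n := fine (cmu Pr X n).

Lemma dist_xx (x : 'cV[R]_q) : Bbar x -> dist x x = 0.
Proof.
move=> Bx; have cx := Bbar_cone Bx; apply/eqP; rewrite eq_le dist_ge0// andbT.
apply: (le_trans (dist_le cx cx)); rewrite subr_le0 -[leLHS]mulr1.
by apply: mprod_ge => // i; rewrite mul1r.
Qed.

Lemma meanY_dist_le1 n (x y : 'cV[R]_q) : Bbar x -> Bbar y ->
  meanY Pr X n (@dist R q) x y <= dist x y.
Proof.
move=> Bx By; have bd := bounded_measurable_dist R q.
elim: n => [|n IH] in x y Bx By *; first by rewrite meanY0.
rewrite (meanYS iidX XS bd)//.
apply: (@le_trans _ _ (meanY Pr X 1 (@dist R q) x y)).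
  exact: (meanY_le iidX XS 1 (meanY_bounded_measurable iidX XS bd n) bd).
have -> : dist x y = \int[Pr]_w (cst (dist x y) w).
  by rewrite Rintegral_cst// [X in fine X]probability_setT mulr1.
rewrite meanY_cut//; apply: le_Rintegral => //.
- exact: (integrable_cut_act iidX bd).
- apply: (@bounded_integrable _ _ _ _ _ `|dist x y|) => //.
move=> w _; have Sw := Yprod_inS XS 1 w.
by rewrite cutE; [exact: dist_act|exact: act_Bbar|exact: act_Bbar].
Qed.

Lemma meanY_dist_ge0 n (x y : 'cV[R]_q) : Bbar x -> Bbar y ->
  0 <= meanY Pr X n (@dist R q) x y.
Proof.
move=> Bx By; apply: Rintegral_ge0 => w _; have Sw := Yprod_inS XS n w.
by apply: dist_ge0; apply: Bbar_cone; exact: act_Bbar.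
Qed.

Lemma cmu_le n (K : R) :
  (forall x y : 'cV[R]_q, Bbar x -> Bbar y -> x <> y ->
    meanY Pr X n (@dist R q) x y <= K * dist x y) -> (cmu Pr X n <= K%:E)%E.
Proof.
move=> H; apply: ge_ereal_sup => _ [[x y] [Bx [By xy]] <-] /=.
by rewrite lee_fin ler_pdivrMr ?dist_gt0//; exact: H.
Qed.

(** The sign of K covers a simplex without two distinct points: the supremum is then [-oo], which
    [fine] sends to 0. *)
Lemma coef_le n (K : R) : 0 <= K ->
  (forall x y : 'cV[R]_q, Bbar x -> Bbar y -> x <> y ->
    meanY Pr X n (@dist R q) x y <= K * dist x y) -> coef n <= K.
Proof.
by move=> K0 /cmu_le; rewrite /coef; case: (cmu Pr X n).
Qed.

Lemma coef_le1 n : coef n <= 1.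
Proof. by apply: coef_le => // x y Bx By _; rewrite mul1r meanY_dist_le1. Qed.

Lemma cmu_ge n (x y : 'cV[R]_q) : Bbar x -> Bbar y -> x <> y ->
  ((meanY Pr X n (@dist R q) x y / dist x y)%:E <= cmu Pr X n)%E.
Proof. by move=> Bx By xy; apply: ereal_sup_ubound; exists (x, y). Qed.

Lemma meanY_dist_le n (x y : 'cV[R]_q) : Bbar x -> Bbar y ->
  meanY Pr X n (@dist R q) x y <= coef n * dist x y.
Proof.
move=> Bx By; have [xy|xy] := pselect (x = y).
  by apply: (le_trans (meanY_dist_le1 n Bx By)); rewrite -xy dist_xx// mulr0.
(* Finiteness comes first, because [fine] would send [+oo] to 0. *)
have c1 : (cmu Pr X n <= 1%:E)%E.
  by apply: cmu_le => x' y' *; rewrite mul1r meanY_dist_le1.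
move: c1 (cmu_ge n Bx By xy); rewrite /coef; case: (cmu Pr X n) => [r| |] //= _.
by rewrite lee_fin ler_pdivrMr// dist_gt0.
Qed.

Lemma coef_ge0 n : 0 <= coef n.
Proof.
have [[x [y [Bx [By xy]]]]|H] := pselect (exists x y : 'cV[R]_q, Bbar x /\ Bbar y /\ x <> y).
  have := le_trans (meanY_dist_ge0 n Bx By) (meanY_dist_le n Bx By).
  by rewrite pmulr_lge0// dist_gt0.
rewrite /coef /cmu (_ : [set _ | _ in _] = set0) ?ereal_sup0//.
by apply/seteqP; split=> // _ [[x y] /= [Bx [By xy]] _]; apply: H; exists x, y.
Qed.

(** With m fixed, [step] adds one factor at a time: [meanY 1] is monotone and linear, so it carries
    the constant [coef m] through the recursion [meanYS]. *)
Lemma coef_submul m n : coef (m + n) <= coef m * coef n.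
Proof.
have bd := bounded_measurable_dist R q.
have bm k := meanY_bounded_measurable iidX XS bd k.
have step (x y : 'cV[R]_q) : Bbar x -> Bbar y -> meanY Pr X (m + n) (@dist R q) x y <=
    coef m * meanY Pr X n (@dist R q) x y.
  elim: n x y => [|n IH] x y Bx By; first by rewrite addn0 meanY0//; exact: meanY_dist_le.
  rewrite addnS !(meanYS iidX XS bd)// -(meanYZ iidX XS (bm n))//.
  apply: (meanY_le iidX XS 1 (bm (m + n)%N)) => //.
  by apply: bounded_measurableZ (bm n); exact: coef_ge0.
apply: coef_le => [|x y Bx By _]; first by rewrite mulr_ge0 ?coef_ge0.
apply: (le_trans (step _ _ Bx By)); rewrite -mulrA ler_wpM2l ?coef_ge0//.
exact: meanY_dist_le.
Qed.

Lemma coef_rate k : kappa Pr X < k < 1 ->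
  exists2 C, 0 < C & forall n, coef n <= C * k ^+ n.
Proof. by apply: root_rate; [exact: coef_ge0|exact: coef_le1|exact: coef_submul]. Qed.

End Coefficient.

(** * Measures determined by continuous functions *)

Section ContinuousFunctionsDetermine.
Variables (R : realType) (q : nat).

(* Requiring both continuity and measurability avoids comparing the
   sigma-algebra generated by the coordinates with the Borel one. *)
Definition zero_sets : set (set (VecT R q)) :=
  [set A | exists phi : 'cV[R]_q -> R,
    [/\ continuous phi, measurable_fun setT (phi : VecT R q -> R),
        (forall x, 0 <= phi x) & A = [set x | phi x = 0]]].

Lemma zero_sets_measurable (A : set (VecT R q)) : zero_sets A -> measurable A.
Proof.
move=> [phi [_ mphi _ ->]]; rewrite -[X in measurable X]setTI.
exact: (mphi measurableT [set 0]).
Qed.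

Lemma zero_setsI : setI_closed zero_sets.
Proof.
move=> _ _ [phi [c1 m1 phi0 ->]] [psi [c2 m2 psi0 ->]].
exists (fun x => phi x + psi x); split.
- by move=> x; exact: (continuousD (c1 x) (c2 x)).
- exact: measurable_funD.
- by move=> x; rewrite addr_ge0.
- apply/seteqP; split=> x /=; first by move=> [-> ->]; rewrite addr0.
  by move=> /eqP; rewrite paddr_eq0// => /andP[/eqP -> /eqP ->].
Qed.

Lemma zero_setsT : zero_sets setT.
Proof.
exists (fun=> 0); split=> //; first by move=> x; exact: cst_continuous.
by apply/seteqP; split.
Qed.

Lemma measurable_zero_sets : @measurable _ (VecT R q) = <<s zero_sets >>.
Proof.
apply/seteqP; split; last first.
  apply: smallest_sub; first exact: sigma_algebra_measurable.
  exact: zero_sets_measurable.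
apply: smallest_sub; first exact: smallest_sigma_algebra.
move=> _ [i [j [B [mB ->]]]].
have mc : measurable_fun setT
    (fun x : g_sigma_algebraType zero_sets => (x : 'cV[R]_q) i j).
  apply: (measurability _ (RGenCInfty.measurableE R)).
  move=> _ [_ [a ->] <-]; apply: sub_sigma_algebra.
  (* This is 2 max(a - x_ij, 0), which vanishes exactly when x_ij >= a. *)
  exists (fun x => `|a - x i j| + (a - x i j)); split.
  - have c : continuous (fun x : 'cV[R]_q => a - x i j).
      by move=> x; apply: continuousB; [exact: cst_continuous|exact: coord_continuous].
    by move=> x; exact: (continuousD (continuous_comp (c x) (@norm_continuous _ _ _)) (c x)).
  - have m : measurable_fun setT (fun x : VecT R q => a - (x : 'cV[R]_q) i j).
      by apply: measurable_funB => //; exact: measurable_coord.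
    by apply: measurable_funD => //; exact: measurableT_comp.
  - by move=> x; have := ler_norm (- (a - x i j)); rewrite normrN; lra.
  - rewrite setTI; apply/seteqP; split=> x /=; rewrite in_itv/= andbT => ax.
      by rewrite ler0_norm ?subr_le0// addNr.
    have := normr_ge0 (a - x i j); lra.
by have := mc measurableT B mB; rewrite setTI.
Qed.

(** The functions exp(-n phi) are bounded by 1 and tend pointwise to the indicator of the zero
    set. *)
Lemma cvg_expR_indic (P : probability (VecT R q) R) (phi : 'cV[R]_q -> R) :
  measurable_fun setT (phi : VecT R q -> R) -> (forall x, 0 <= phi x) ->
  (fun n => (\int[P]_x (expR (- (n%:R * phi x)))%:E)%E) @ \oo -->
    P [set x | phi x = 0].
Proof.
move=> mphi phi0.
have mA : measurable [set x : VecT R q | phi x = 0].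
  by rewrite -[X in measurable X]setTI; exact: (mphi measurableT [set 0]).
rewrite (_ : P _ = \int[P]_x (\1_[set x : VecT R q | phi x = 0] x)%:E)%E; last first.
  by rewrite integral_indic// setIT.
apply: (@dominated_cvg _ _ _ P setT measurableT _ _ (cst 1%E)) => //.
- move=> n; apply/measurable_EFinP; apply: (measurableT_comp (@measurable_expR R)).
  by apply: measurableT_comp => //; apply: measurable_funM.
- move=> x _; apply: cvg_EFin; first exact: nearW.
  rewrite indicE; have [px|px] := eqVneq (phi x) 0.
    rewrite mem_set// px; under eq_fun do rewrite /= mulr0 oppr0 expR0.
    exact: cvg_cst.
  rewrite memNset; last by apply/eqP.
  have px0 : 0 < phi x by rewrite lt_neqAle eq_sym px phi0.
  apply/cvgrPdist_lt => e e0; near=> n.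
  rewrite sub0r normrN ger0_norm ?expR_ge0//= expRN.
  have n0 : (0 < n)%N by near: n; exact: nbhs_infty_gt.
  have np : 0 < n%:R * phi x by rewrite mulr_gt0// ltr0n.
  (* From exp(t) >= 1 + t >= t with t = n phi(x). *)
  apply: (@le_lt_trans _ _ (n%:R * phi x)^-1).
    rewrite lef_pV2 ?posrE ?expR_gt0//.
    by apply: le_trans (expR_ge1Dx _); rewrite lerDr.
  rewrite invf_plt ?posrE// -ltr_pdivrMr//.
  by near: n; exact: nbhs_infty_gtr.
- by apply: (@bounded_integrable _ _ _ P (cst 1) 1) => // x; rewrite normr1.
- move=> n x _; rewrite lee_fin ger0_norm ?expR_ge0// -expR0 ler_expR oppr_le0.
  by rewrite mulr_ge0.
Unshelve. all: by end_near. Qed.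

(** Testing against exp(-n phi) gives equality on zero sets, a generating pi-system. *)
Lemma probability_eq_continuous (P1 P2 : probability (VecT R q) R) :
  (forall f : 'cV[R]_q -> R, continuous f -> measurable_fun setT (f : VecT R q -> R) ->
     (forall x, 0 <= f x <= 1) -> \int[P1]_x f x = \int[P2]_x f x) ->
  forall A, measurable A -> P1 A = P2 A.
Proof.
move=> P12 A mA.
apply: (measure_unique zero_sets (fun=> setT)) => //.
- exact: measurable_zero_sets.
- exact: zero_setsI.
- by move=> _; exact: zero_setsT.
- by rewrite bigcup_const//; exists 0%N.
- move=> _ [phi [cphi mphi phi0 ->]].
  transitivity (limn (fun n => (\int[P1]_x (expR (- (n%:R * phi x)))%:E)%E)).
    by apply/esym/cvg_lim => //; exact: cvg_expR_indic.
  transitivity (limn (fun n => (\int[P2]_x (expR (- (n%:R * phi x)))%:E)%E)); last first.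
    by apply/cvg_lim => //; exact: cvg_expR_indic.
  congr (limn _).
  apply/funext => n.
  have mf : measurable_fun setT ((fun x => expR (- (n%:R * phi x))) : VecT R q -> R).
    apply: (measurableT_comp (@measurable_expR R)).
    by apply: measurableT_comp => //; apply: measurable_funM.
  have f01 x : 0 <= expR (- (n%:R * phi x)) <= 1.
    by rewrite expR_ge0 -expR0 ler_expR oppr_le0 mulr_ge0.
  have fin (P : probability (VecT R q) R) :
      (\int[P]_x (expR (- (n%:R * phi x)))%:E)%E \is a fin_num.
    apply: integrable_fin_num => //; apply: (@bounded_integrable _ _ _ P _ 1) => //.
    by move=> x; have /andP[h1 h2] := f01 x; rewrite ger0_norm.
  rewrite -[LHS]fineK// -[RHS]fineK//; congr EFin.
  apply: (P12 (fun x => expR (- (n%:R * phi x)))) => //.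
  move=> x; apply: continuous_comp; last exact: continuous_expR.
  by apply: continuousN; apply: continuousM; [exact: cst_continuous|exact: cphi].
- by move=> _; apply: (@le_lt_trans _ _ 1%E); rewrite ?ltry// -(probability_setT P1).
Qed.

End ContinuousFunctionsDetermine.

(** * The Markov operator *)

Section MarkovOperator.
Context (R : realType) (q : nat) d (Omega : measurableType d).
Variables (Pr : probability Omega R) (X : nat -> Omega -> 'M[R]_q).
Hypothesis iidX : iid_mx Pr X.
Hypothesis XS : forall n w, inS (X n w).
Variables (mu : probability (MatT R q) R) (nu : probability (VecT R q) R).
Hypothesis muE : forall A : set (MatT R q), measurable A ->
  mu A = Pr ((fun w => (X 0%N w)^T) @^-1` A).
Hypothesis nu_Bbar : nu (@Bbar R q) = 1%E.
Hypothesis mu_nu : mu_invariant mu nu.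
Implicit Types (u : 'cV[R]_q -> R) (f : 'cV[R]_q -> R[i]).

Local Notation first u := (fun a (_ : 'cV[R]_q) => u a).

Lemma mu_inS : mu (@inS R q) = 1%E.
Proof.
rewrite muE; last exact: measurable_inS.
rewrite (_ : _ @^-1` _ = setT) ?probability_setT//.
by apply/seteqP; split=> // w _; apply: inS_tr.
Qed.

Lemma measurable_cut_diag u M : bounded_measurable (first u) M ->
  measurable_fun setT (fun x : VecT R q => cut (first u) (x, x)).
Proof.
move=> bu.
have md : measurable_fun setT (fun x : VecT R q => (x, x)).
  exact: (measurable_fun_pair (@measurable_id _ _ _) (@measurable_id _ _ _)).
exact: (measurableT_comp (measurable_cut bu) md).
Qed.

Lemma measurable_act_l (x : 'cV[R]_q) :
  measurable_fun setT (fun g : MatT R q => act (g : 'M[R]_q) x : VecT R q).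
Proof.
apply: measurable_mx => i j; apply: measurable_act => k l; last exact: measurable_cst.
exact: measurable_coord.
Qed.

Lemma Rintegral_mu u M x : bounded_measurable (first u) M -> Bbar x ->
  \int[mu]_g u (act g x) = meanY Pr X 1 (first u) x x.
Proof.
move=> bu Bx; rewrite meanY_cut//.
rewrite (Rintegral_full (g := fun g : MatT R q => cut (first u) (act g x, act g x))
  (@measurable_inS R q) mu_inS); last first.
  by move=> g Sg; rewrite cutE//; exact: act_Bbar.
have mX : measurable_fun setT (fun w => (X 0%N w)^T : MatT R q).
  by apply: measurable_tr; exact: iid_measurable iidX 0%N.
rewrite (@Rintegral_law _ _ _ _ _ Pr mu _ _ M mX muE).
- by apply: eq_Rintegral => w _; rewrite YprodS Yprod0 mul1mx.
- exact: (measurableT_comp (measurable_cut_diag bu) (measurable_act_l x)).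
- by move=> g; exact: cut_bound.
Qed.

(** Here p is the real or imaginary part, which commutes with the componentwise [cint]. The iterates
    are identified on the simplex only; this suffices because mu is carried by S, which preserves
    the simplex. *)
Lemma iter_Pop (p : R[i] -> R) f M n x :
  (forall h y, p (Pop mu h y) = \int[mu]_g p (h (act g y))) ->
  bounded_measurable (first (p \o f)) M -> Bbar x ->
  p (iter n (Pop mu) f x) = meanY Pr X n (first (p \o f)) x x.
Proof.
move=> pE bu; elim: n x => [|n IH] x Bx; first by rewrite meanY0.
have bn := meanY_bounded_measurable iidX XS bu n.
rewrite (meanYS iidX XS bu)// /= pE.
rewrite (Rintegral_full (g := fun g : MatT R q => meanY Pr X n (first (p \o f)) (act g x) (act g x))
  (@measurable_inS R q) mu_inS).
  exact: (@Rintegral_mu (fun y => meanY Pr X n (first (p \o f)) y y) M).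
by move=> g Sg; apply: IH; exact: act_Bbar.
Qed.

Lemma measurable_act_pair_fun :
  measurable_fun setT (fun z : VecT R q * MatT R q => act (z.2 : 'M[R]_q) z.1 : VecT R q).
Proof.
apply: measurable_mx => i j; apply: measurable_act => k l.
  exact: (measurable_mx_coord k l measurable_snd).
exact: (measurable_mx_coord k l measurable_fst).
Qed.

(** The law of g.x when x has law nu and g has law mu, independently. *)
Definition one_step : probability (VecT R q) R :=
  distribution (nu \x mu)%E (mfun_of measurable_act_pair_fun).

Lemma Rintegral_one_step (phi : VecT R q -> R) M : measurable_fun setT phi ->
  (forall x, `|phi x| <= M) ->
  \int[one_step]_x phi x = \int[nu]_x \int[mu]_g phi (act g x).
Proof.
move=> mphi phiM.
have m2 := measurableT_comp mphi measurable_act_pair_fun.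
rewrite (@Rintegral_law _ _ _ _ _ (nu \x mu)%E one_step _ _ M measurable_act_pair_fun)//.
exact: (esym (@Rintegral_product _ _ _ _ _ nu mu M _ m2 (fun z => phiM _))).
Qed.

(** This extends invariance from continuous to Borel functions, hence to discontinuous d-Lipschitz
    ones. *)
Lemma one_step_nu A : measurable A -> one_step A = nu A.
Proof.
apply: probability_eq_continuous => f cf mf f01.
have f1 x : `|f x| <= 1 by have /andP[h1 h2] := f01 x; rewrite ger0_norm.
have mB : measurable (@Bbar R q : set (VecT R q)) by exact: measurable_Bbar.
rewrite (Rintegral_one_step mf f1) -(Rintegral_fullT _ mB nu_Bbar).
rewrite mu_nu; first by rewrite (Rintegral_fullT _ mB nu_Bbar).
  by exists 1 => x _.
exact: continuous_subspaceT.
Qed.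

Lemma nu_meanY1 u M : bounded_measurable (first u) M ->
  \int[nu]_(x in Bbar (q := q)) meanY Pr X 1 (first u) x x =
  \int[nu]_(x in Bbar (q := q)) u x.
Proof.
move=> bu; have mB : measurable (@Bbar R q : set (VecT R q)) by exact: measurable_Bbar.
rewrite !(Rintegral_fullT _ mB nu_Bbar).
have mc := measurable_cut_diag bu.
have cM x : `|cut (first u) (x, x)| <= M by exact: cut_bound.
transitivity (\int[nu]_x \int[mu]_g cut (first u) (act g x, act g x)).
  apply: (Rintegral_full mB nu_Bbar) => x Bx.
  rewrite -(Rintegral_mu bu Bx); apply: (Rintegral_full (@measurable_inS R q) mu_inS).
  by move=> g Sg; rewrite cutE//; exact: act_Bbar.
rewrite -(Rintegral_one_step mc cM).
transitivity (\int[nu]_x cut (first u) (x, x)).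
  by congr fine; apply: eq_measure_integral => A mA _; exact: one_step_nu.
by apply: (Rintegral_full mB nu_Bbar) => x Bx; rewrite cutE.
Qed.

Lemma nu_meanY n u M : bounded_measurable (first u) M ->
  \int[nu]_(x in Bbar (q := q)) meanY Pr X n (first u) x x =
  \int[nu]_(x in Bbar (q := q)) u x.
Proof.
move=> bu; elim: n => [|n IH].
  by apply: eq_Rintegral => x; rewrite inE => Bx; rewrite meanY0.
have bn := meanY_bounded_measurable iidX XS bu n.
rewrite -IH; apply: etrans (nu_meanY1 (u := fun y => meanY Pr X n (first u) y y) bn).
by apply: eq_Rintegral => x; rewrite inE => Bx; rewrite (meanYS iidX XS bu).
Qed.

Lemma Bbar_nonempty : exists x, @Bbar R q x.
Proof.
apply: contrapT => H; have : @Bbar R q = set0.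
  by apply/seteqP; split=> // x Bx; apply: H; exists x.
by move=> B0; move: nu_Bbar; rewrite B0 measure0 => /esym/eqP; rewrite onee_eq0.
Qed.

(** * Real d-Lipschitz functions *)

Section lipschitz.
Variables (u : 'cV[R]_q -> R) (L : R).
Hypothesis L0 : 0 <= L.
Hypothesis uL : forall x y, Bbar x -> Bbar y -> `|u x - u y| <= L * dist x y.

Lemma lipschitz_bounded_measurable :
  exists M, bounded_measurable (first u) M /\ bounded_measurable (fun _ b => u b) M.
Proof.
have [x0 B0] := Bbar_nonempty.
have mu_ := measurable_lipschitz L0 uL.
have ub x : Bbar x -> `|u x| <= `|u x0| + L.
  move=> Bx; have := uL Bx B0; have := dist_le1 (Bbar_cone Bx) (Bbar_cone B0).
  move=> d1 ul; apply: (@le_trans _ _ (`|u x0| + `|u x - u x0|)).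
    by rewrite -{1}(subrK (u x0) (u x)) addrC ler_normD.
  by rewrite lerD2l (le_trans ul)// ler_piMr.
have M0 : 0 <= `|u x0| + L by rewrite addr_ge0.
exists (`|u x0| + L).
by split; [exact: bounded_measurable_fst|exact: bounded_measurable_snd].
Qed.

(** The difference of averages is the average of the kernel u(a) - u(b), dominated by L d(a, b). By
    symmetry of d a one-sided bound is enough. *)
Lemma meanY_lipschitz n x y : Bbar x -> Bbar y ->
  `|meanY Pr X n (first u) x x - meanY Pr X n (first u) y y| <=
  L * coef Pr X n * dist x y.
Proof.
have [M [b1 b2]] := lipschitz_bounded_measurable.
have bd := bounded_measurableZ L0 (bounded_measurable_dist R q).
suff H x' y' : Bbar x' -> Bbar y' ->
    meanY Pr X n (first u) x' x' - meanY Pr X n (first u) y' y' <=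
    L * coef Pr X n * dist x' y'.
  move=> Bx By; rewrite ler_norml H// andbT lerNl opprB.
  have -> : dist x y = dist y x by rewrite /dist [mfun x y * _]mulrC.
  exact: H.
move=> {x y} Bx By.
have -> : meanY Pr X n (first u) x' x' - meanY Pr X n (first u) y' y' =
    meanY Pr X n (fun a b => u a - u b) x' y'.
  by rewrite (meanYB iidX XS n b1 b2 Bx By).
apply: (@le_trans _ _ (meanY Pr X n (fun a b => L * dist a b) x' y')).
  apply: (meanY_le iidX XS n (bounded_measurableB b1 b2) bd) => // a b Ba Bb.
  exact: le_trans (ler_norm _) (uL Ba Bb).
rewrite (meanYZ iidX XS (bounded_measurable_dist R q))// -mulrA ler_wpM2l//.
exact: meanY_dist_le.
Qed.

Lemma meanY_nu_le n x : Bbar x ->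
  `|meanY Pr X n (first u) x x - \int[nu]_(y in Bbar (q := q)) u y| <=
  L * coef Pr X n.
Proof.
move=> Bx; have [M [b1 _]] := lipschitz_bounded_measurable.
have mB : measurable (@Bbar R q : set (VecT R q)) by exact: measurable_Bbar.
have bn := meanY_bounded_measurable iidX XS b1 n.
rewrite -(nu_meanY n b1) (Rintegral_fullT _ mB nu_Bbar).
pose v y := meanY Pr X n (first u) y y; rewrite -/(v x) -[X in _ - X]/(\int[nu]_y v y).
have mc := measurable_cut_diag bn.
have Lc0 : 0 <= L * coef Pr X n by rewrite mulr_ge0 ?coef_ge0.
have cM y : `|cut (first v) (y, y)| <= M by apply: cut_bound; exact: bn.
have mv : measurable_fun setT (fun y : VecT R q => cut (first v) (y, y)) by exact: mc.
have -> : \int[nu]_y v y = \int[nu]_y cut (first v) (y, y).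
  by apply: (Rintegral_full mB nu_Bbar) => y By; rewrite cutE.
have -> : v x = \int[nu]_y cst (v x) y.
  by rewrite Rintegral_cst// [X in fine X]probability_setT mulr1.
have ic : nu.-integrable setT (EFin \o cst (v x)).
  by apply: (@bounded_integrable _ _ _ _ _ `|v x|).
rewrite -(RintegralB measurableT ic (bounded_integrable nu mv cM)).
(* [Rintegral_bound] asks for a bound at every y, so the integrand is killed off the simplex. *)
rewrite (Rintegral_full (g := fun y => (v x - cut (first v) (y, y)) *
  (\1_(@Bbar R q : set (VecT R q)) y)) mB nu_Bbar); last first.
  by move=> y By; rewrite indicE mem_set// mulr1.
apply: Rintegral_bound.
  apply: measurable_funM; last exact: measurable_indic.
  by apply: measurable_funB => //.
move=> y; rewrite indicE; have [By|nBy] := pselect (Bbar y).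
  rewrite mem_set// mulr1 cutE//.
  apply: (le_trans (meanY_lipschitz n Bx By)); rewrite ler_piMr//.
  exact: dist_le1 (Bbar_cone Bx) (Bbar_cone By).
by rewrite memNset// mulr0 normr0.
Qed.

End lipschitz.

(** * Complex functions and operator norms *)

Lemma normr_Re_le (z : R[i]) : `|complex.Re z| <= cabs z.
Proof. by rewrite -sqrtr_sqr ler_wsqrtr// lerDl sqr_ge0. Qed.

Lemma normr_Im_le (z : R[i]) : `|complex.Im z| <= cabs z.
Proof. by rewrite -sqrtr_sqr ler_wsqrtr// lerDr sqr_ge0. Qed.

Lemma cabs_le (z : R[i]) (a b : R) :
  `|complex.Re z| <= a -> `|complex.Im z| <= b -> cabs z <= a + b.
Proof.
move=> ha hb; have a0 := le_trans (normr_ge0 _) ha; have b0 := le_trans (normr_ge0 _) hb.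
rewrite /cabs -(ger0_norm (addr_ge0 a0 b0)) -sqrtr_sqr ler_wsqrtr//.
rewrite -(real_normK (num_real (complex.Re z))) -(real_normK (num_real (complex.Im z))).
have := normr_ge0 (complex.Re z); have := normr_ge0 (complex.Im z).
by move: `|_| `|_| ha hb => s t *; nra.
Qed.

Lemma ReB (z w : R[i]) : complex.Re (z - w) = complex.Re z - complex.Re w.
Proof. by case: z w => [a b] [a' b']. Qed.

Lemma ImB (z w : R[i]) : complex.Im (z - w) = complex.Im z - complex.Im w.
Proof. by case: z w => [a b] [a' b']. Qed.

Lemma Lip_le f (L : R) x y : (Lip f <= L%:E)%E -> Bbar x -> Bbar y ->
  cabs (f x - f y) <= L * dist x y.
Proof.
move=> fL Bx By; have [->|/eqP xy] := eqVneq x y.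
  by rewrite subrr dist_xx// mulr0 /cabs /= expr0n /= addr0 sqrtr0.
rewrite -ler_pdivrMr ?dist_gt0// -lee_fin; apply: le_trans fL.
by apply: ereal_sup_ubound; exists (x, y).
Qed.

Lemma Lip_ge f (L : R) : (forall x y, Bbar x -> Bbar y ->
  cabs (f x - f y) <= L * dist x y) -> (Lip f <= L%:E)%E.
Proof.
move=> fL; apply: ge_ereal_sup => _ [[x y] [Bx [By xy]] <-].
by rewrite lee_fin ler_pdivrMr ?dist_gt0//; exact: fL.
Qed.

Lemma supnorm_ge f (K : R) : (forall x, Bbar x -> cabs (f x) <= K) ->
  (supnorm f <= K%:E)%E.
Proof. by move=> fK; apply: ge_ereal_sup => _ [x Bx <-]; rewrite lee_fin fK. Qed.

Lemma Lip_le1 f : (normL f <= 1)%E -> (Lip f <= 1%:E)%E.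
Proof.
apply: le_trans; rewrite /normL leeDr//.
have [x Bx] := Bbar_nonempty.
apply: (@le_trans _ _ (cabs (f x))%:E); first by rewrite lee_fin sqrtr_ge0.
by apply: ereal_sup_ubound; exists x.
Qed.

Section estimates.
Variables (f : 'cV[R]_q -> R[i]) (L : R).
Hypotheses (L0 : 0 <= L) (fL : (Lip f <= L%:E)%E).

Let Re_lip x y : Bbar x -> Bbar y ->
  `|(@complex.Re R \o f) x - (@complex.Re R \o f) y| <= L * dist x y.
Proof.
by move=> Bx By; rewrite -ReB; apply: le_trans (normr_Re_le _) (Lip_le fL Bx By).
Qed.

Let Im_lip x y : Bbar x -> Bbar y ->
  `|(@complex.Im R \o f) x - (@complex.Im R \o f) y| <= L * dist x y.
Proof.
by move=> Bx By; rewrite -ImB; apply: le_trans (normr_Im_le _) (Lip_le fL Bx By).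
Qed.

Lemma Re_iter_Pop n x : Bbar x -> complex.Re (iter n (Pop mu) f x) =
  meanY Pr X n (first (@complex.Re R \o f)) x x.
Proof.
have [M [bM _]] := lipschitz_bounded_measurable L0 Re_lip.
exact: (iter_Pop n (fun _ _ => erefl) bM).
Qed.

Lemma Im_iter_Pop n x : Bbar x -> complex.Im (iter n (Pop mu) f x) =
  meanY Pr X n (first (@complex.Im R \o f)) x x.
Proof.
have [M [bM _]] := lipschitz_bounded_measurable L0 Im_lip.
exact: (iter_Pop n (fun _ _ => erefl) bM).
Qed.

(** The constant c cancels in differences: c = 0 serves for P itself, and the constant value of
    [Piop nu f] for P^n - Pi. *)
Lemma Lip_iter_Pop n (c : R[i]) :
  (Lip (fun x => (iter n (Pop mu) f x - c)%R) <= (2 * (L * coef Pr X n))%:E)%E.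
Proof.
apply: Lip_ge => x y Bx By.
have -> : iter n (Pop mu) f x - c - (iter n (Pop mu) f y - c) =
    iter n (Pop mu) f x - iter n (Pop mu) f y by rewrite opprB addrA subrK.
rewrite mulrDl mul1r mulrDl; apply: cabs_le.
- by rewrite ReB !Re_iter_Pop//; exact: meanY_lipschitz.
- by rewrite ImB !Im_iter_Pop//; exact: meanY_lipschitz.
Qed.

Lemma supnorm_iter_Pop n :
  (supnorm (fun x => (iter n (Pop mu) f x - Piop nu f x)%R) <= (2 * (L * coef Pr X n))%:E)%E.
Proof.
apply: supnorm_ge => x Bx; rewrite mulrDl mul1r; apply: cabs_le.
- by rewrite ReB Re_iter_Pop//; exact: (meanY_nu_le L0 Re_lip).
- by rewrite ImB Im_iter_Pop//; exact: (meanY_nu_le L0 Im_lip).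
Qed.

Lemma supnorm_Pop (K : R) : (supnorm f <= K%:E)%E ->
  (supnorm (Pop mu f) <= (2 * K)%:E)%E.
Proof.
move=> fK; have fb x : Bbar x -> cabs (f x) <= K.
  by move=> Bx; rewrite -lee_fin; apply: le_trans fK; apply: ereal_sup_ubound; exists x.
have K0 : 0 <= K.
  by have [x Bx] := Bbar_nonempty; apply: le_trans (fb _ Bx); exact: sqrtr_ge0.
have bnd (p : R[i] -> R) : (forall z, `|p z| <= cabs z) ->
    (forall x y, Bbar x -> Bbar y -> `|(p \o f) x - (p \o f) y| <= L * dist x y) ->
    forall x, Bbar x -> `|meanY Pr X 1 (first (p \o f)) x x| <= K.
  move=> pz pL x Bx.
  have b : bounded_measurable (first (p \o f)) K.
    apply: bounded_measurable_fst => //; first exact: measurable_lipschitz L0 pL.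
    by move=> y By; apply: le_trans (pz _) (fb _ By).
  by have [_ _] := meanY_bounded_measurable iidX XS b 1; apply.
apply: supnorm_ge => x Bx; rewrite mulrDl mul1r; apply: cabs_le.
- by rewrite (Re_iter_Pop 1 Bx); apply: bnd => //; exact: normr_Re_le.
- by rewrite (Im_iter_Pop 1 Bx); apply: bnd => //; exact: normr_Im_le.
Qed.

End estimates.

Lemma Lip_Pop f (L : R) : 0 <= L -> (Lip f <= L%:E)%E ->
  (Lip (Pop mu f) <= (2 * L)%:E)%E.
Proof.
move=> L0 fL; have := Lip_iter_Pop L0 fL 1 0.
rewrite (_ : (fun x => _) = Pop mu f); last by apply/funext => x; rewrite subr0.
move=> h; apply: (le_trans h); rewrite lee_fin ler_pM2l// ler_piMr//.
exact: coef_le1.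
Qed.

Lemma Pop_inL f : inL f -> inL (Pop mu f).
Proof.
move=> fL; have [L L0 {}fL] : exists2 L, 0 <= L & (Lip f <= L%:E)%E.
  move: fL; rewrite /inL; case: (Lip f) => [r _| |_] //; last by exists 0; rewrite ?leNye.
  by exists `|r|; rewrite ?lee_fin ?ler_norm.
exact: le_lt_trans (Lip_Pop L0 fL) (ltry _).
Qed.

(** With two distinct points in the simplex, Lip f >= 0 and the sup norm of f is at most 1.
    Otherwise every Lip is a supremum over the empty set, so the norm of P f is [-oo]. *)
Lemma opnorm_Pop : (opnorm (Pop mu) < +oo)%E.
Proof.
apply: (@le_lt_trans _ _ 4%:E); last exact: ltry.
apply: ge_ereal_sup => _ [f [_ f1] <-]; have lf := Lip_le1 f1.
have lP := Lip_Pop ler01 lf.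
have [[x [y [Bx [By xy]]]]|H] := pselect (exists x y : 'cV[R]_q, Bbar x /\ Bbar y /\ x <> y).
  have sf : (supnorm f <= 1%:E)%E.
    apply: le_trans f1; rewrite /normL leeDl//.
    apply: (@le_trans _ _ (cabs (f x - f y) / dist x y)%:E).
      by rewrite lee_fin divr_ge0 ?sqrtr_ge0// ltW// dist_gt0.
    by apply: ereal_sup_ubound; exists (x, y).
  have := leeD (supnorm_Pop ler01 lf sf) lP.
  by rewrite -EFinD (_ : 2 * 1 + 2 * 1 = 4 :> R)//; lra.
rewrite /normL (_ : Lip (Pop mu f) = -oo)%E ?addeNy ?leNye//.
rewrite /Lip (_ : [set _ | _ in _] = set0) ?ereal_sup0//.
by apply/seteqP; split=> // _ [[x y] /= [Bx [By xy]] _]; apply: H; exists x, y.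
Qed.

(** P^n - Pi annihilates constants, so Lip f <= 1 controls both halves of the norm, each by twice
    the coefficient. *)
Lemma opnorm_iter_Pop n :
  (opnorm (fun f x => (iter n (Pop mu) f x - Piop nu f x)%R) <= (4 * coef Pr X n)%:E)%E.
Proof.
apply: ge_ereal_sup => _ [f [_ f1] <-]; have lf := Lip_le1 f1.
have := leeD (supnorm_iter_Pop ler01 lf n) (Lip_iter_Pop ler01 lf n (Piop nu f 0)).
rewrite -EFinD (_ : 2 * (1 * coef Pr X n) + _ = 4 * coef Pr X n)//.
by rewrite mul1r; lra.
Qed.

End MarkovOperator.

Theorem mainTheorem4 (R : realType) (q : nat)
  (d : measure_display) (Omega : measurableType d) (Pr : probability Omega R)
  (X : nat -> Omega -> 'M[R]_q)
  (mu : probability (MatT R q) R) (nu : probability (VecT R q) R) :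
  (* (X_n) is an i.i.d. sequence in S  (X_1 is X 0) *)
  iid_mx Pr X ->
  (forall n w, inS (X n w)) ->
  (* P( U_{n>=1} [X_n ... X_1 in S°] ) > 0 *)
  (0 < Pr [set w | exists n, inSo (Lprod X n w)])%E ->
  (* mu is the law of Y_1 = X_1^T *)
  (forall A : set (MatT R q), measurable A ->
     mu A = Pr ((fun w => (X 0%N w)^T) @^-1` A)) ->
  (* nu is the (unique) mu-invariant probability measure on Bbar *)
  nu (@Bbar R q) = 1%E ->
  mu_invariant mu nu ->
  (* P is a bounded operator on L *)
  ((forall f, inL f -> inL (Pop mu f)) /\ (opnorm (Pop mu) < +oo)%E) /\
  (* exponential convergence of P^n to Pi in operator norm *)
  (forall kappa0 : R, kappa Pr X < kappa0 < 1 ->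
     exists C : R, 0 < C /\
       forall n : nat, (0 < n)%N ->
         (opnorm (fun f x => (iter n (Pop mu) f x - Piop nu f x)%R)
            <= (C * kappa0 ^+ n)%:E)%E).
Proof.
move=> iidX XS _ muE nuB mu_nu; split; first split.
- by move=> f; exact: (Pop_inL iidX XS muE nuB).
- exact: (opnorm_Pop iidX XS muE nuB).
move=> k /(coef_rate iidX XS)[C C0 HC]; exists (4 * C); split; first by rewrite mulr_gt0.
move=> n _; apply: (le_trans (opnorm_iter_Pop iidX XS muE nuB mu_nu n)).
by rewrite lee_fin -mulrA ler_pM2l.
Qed.
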